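(* Assume that the regularization parameter $\alpha$ satisfies $$\alpha > \frac14 \sum_{\nu=1}^N \big\| \chi_Z (S_\nu - \chi_\nu S_\nu)\big\|_{L^2(\Omega)\to L^2(\Omega)}^2 .$$ Then the Nash equilibrium problem in which, for $\nu=1,\dots,N$, player $\nu$ solves $$\min_{u^\nu\in L^2(\Omega)}\ f_\nu(u) = \frac12\|Su-y_d^\nu\|_{L^2(\Omega_\nu)}^2+\frac{\alpha}{2}\|u^\nu\|_{L^2(\Omega)}^2\quad\text{s.t. } u^\nu\in U_{\mathrm{ad}}^\nu$$ has a unique solution.
   Context: Let $\Omega\subset\mathbb{R}^n$, $n\in\{1,2,3\}$, be a bounded Lipschitz domain, $N\in\mathbb{N}$ the number of players, and $U:=L^2(\Omega)^N$. Elements of $U$ are written $u=(u^1,\dots,u^N)=(u^\nu,u^{-\nu})$, where $u^{-\nu}$ collects all components except the $\nu$-th. Given $u_a^\nu,u_b^\nu\in L^2(\Omega)$ with $u_a^\nu\le u_b^\nu$ a.e., set $U_{\mathrm{ad}}^\nu:=\{u^\nu\in L^2(\Omega): u_a^\nu(x)\le u^\nu(x)\le u_b^\nu(x)\text{ for a.e. }x\in\Omega\}$ and $U_{\mathrm{ad}}:=U_{\mathrm{ad}}^1\times\dots\times U_{\mathrm{ad}}^N$. Let $y_d^\nu\in L^2(\Omega)$. Let $Y$ be a state space continuously embedded in $L^q(\Omega)$ for some $q>2$, and let $A:Y\to H^{-1}(\Omega)$ be linear, bounded and continuously invertible (a linear elliptic operator). Set $S_\nu:=A^{-1}:H^{-1}(\Omega)\to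 Y\hookrightarrow L^q(\Omega)$ for every $\nu$ and $Su:=A^{-1}\sum_{\nu=1}^N u^\nu=\sum_{\nu=1}^N S_\nu u^\nu$. Via $L^2(\Omega)\hookrightarrow H^{-1}(\Omega)$ and $L^q(\Omega)\hookrightarrow L^2(\Omega)$, $S_\nu$ is also regarded as a bounded operator on $L^2(\Omega)$. Let $\Omega_\nu\subseteq\Omega$ be measurable for $\nu=1,\dots,N$, let $\chi_\nu$ be the characteristic function of $\Omega_\nu$, $Z:=\bigcup_{\nu=1}^N\Omega_\nu$, and $\chi_Z$ the characteristic function of $Z$. Multiplication by a characteristic function is regarded as an operator on $L^2(\Omega)$. A solution of the Nash equilibrium problem is a point $\bar u\in U_{\mathrm{ad}}$ such that for every $\nu$, $f_\nu(\bar u^\nu,\bar u^{-\nu})\le f_\nu(v^\nu,\bar u^{-\nu})$ for all $v^\nu\in U_{\mathrm{ad}}^\nu$. *)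

(* Defs.v *)
From HB Require Import structures.
From mathcomp Require Import all_boot all_order all_algebra.
From mathcomp Require Import ring lra.
From mathcomp Require Import all_classical all_reals all_analysis.
From mathcomp Require Import measurable_realfun.

Set Implicit Arguments.
Unset Strict Implicit.
Unset Printing Implicit Defensive.
Import Order.TTheory GRing.Theory Num.Theory.
Import numFieldNormedType.Exports.
Local Open Scope classical_set_scope.
Local Open Scope ring_scope.

Section measurable_rV.
Context {R : realType} (n : nat).

Let coord : 'I_n -> 'rV[R]_n -> measurableTypeR R := fun i x => x 0 i.

Let rV_set0 : g_sigma_preimage coord set0.
Proof. exact: sigma_algebra0. Qed.

Let rV_setC A : g_sigma_preimage coord A -> g_sigma_preimage coord (~` A).
Proof. exact: sigma_algebraC. Qed.

Let rV_bigcup (F : (set _)^nat) : (forall i, g_sigma_preimage coord (F i)) ->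
  g_sigma_preimage coord (\bigcup_i (F i)).
Proof. exact: sigma_algebra_bigcup. Qed.

HB.instance Definition _ := @isMeasurable.Build default_measure_display
  'rV[R]_n (g_sigma_preimage coord) rV_set0 rV_setC rV_bigcup.

Lemma measurable_coord (i : 'I_n) :
  measurable_fun [set: 'rV[R]_n] (fun x : 'rV[R]_n => x 0 i : measurableTypeR R).
Proof.
move=> _ Y mY; rewrite setTI; apply: sub_sigma_algebra => /=.
rewrite -bigcup_seq/=; exists i => /=; first by rewrite mem_index_enum.
by exists Y => //; rewrite setTI.
Qed.

Lemma measurable_fun_rV d (T : measurableType d) (f : T -> 'rV[R]_n) :
  (forall i, measurable_fun [set: T] (fun x => f x 0 i : measurableTypeR R)) ->
  measurable_fun [set: T] f.
Proof.
move=> mf.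
have : g_sigma_preimage (fun i => coord i \o f) `<=` measurable.
  apply: smallest_sub; first exact: sigma_algebra_measurable.
  rewrite -bigcup_seq; apply: bigcup_sub => i _.
  by move=> A [B mB <-]; exact: mf.
rewrite g_sigma_preimage_comp => H _ A mA; apply: H.
by exists A => //.
Qed.

Lemma open_measurable_rV (A : set 'rV[R]_n) : open A -> measurable A.
Proof.
move=> oA.
pose B (p : 'rV[rat]_n * nat) : set 'rV[R]_n :=
  [set x | forall i, `| ratr (p.1 0 i) - x 0 i| < p.2.+1%:R^-1].
have mB p : measurable (B p).
  have -> : B p = ~` \bigcup_i ~` ((fun x : 'rV[R]_n => x 0 i : measurableTypeR R)
        @^-1` ball (ratr (p.1 0 i) : R) p.2.+1%:R^-1).
    rewrite setC_bigcup; apply/seteqP; split=> [x Bx i _|x Bx i].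
      by apply; exact: Bx.
    by apply: contrapT; exact: Bx i I.
  apply: measurableC; apply: countable_bigcupT_measurable => // i.
  apply: measurableC; rewrite -[X in measurable X]setTI.
  by apply: measurable_coord => //; apply: (@open_measurable R); exact: ball_open.
have -> : A = \bigcup_p (if pselect (B p `<=` A) then B p else set0).
  apply/seteqP; split=> [x Ax|x [p _]]; last by case: pselect => //= BA /BA.
  have /nbhs_ballP[e /= e0 xeA] := open_nbhs_nbhs (conj oA Ax).
  have [k] : exists k : nat, 0 + k.+1%:R^-1 < e / 2.
    by apply: ltr_add_invr; rewrite divr_gt0.
  rewrite add0r => ke.
  have : forall i, exists r : rat, `|ratr r - x 0 i| < k.+1%:R^-1.
    move=> i; have : x 0 i - k.+1%:R^-1 < x 0 i + k.+1%:R^-1.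
      by rewrite ltrD2l gt0_cp// invr_gt0.
    move=> /rat_in_itvoo[r]; rewrite in_itv /= => /andP[h1 h2]; exists r.
    by rewrite ltr_distl h1.
  move=> /choice[r hr].
  exists (\row_i r i, k) => //; case: pselect => [BA /= i|/= []].
    by rewrite mxE; exact: hr.
  move=> y By; apply: xeA; split=> // i j; rewrite ord1 /ball /=.
  rewrite (@lt_trans _ _ (k.+1%:R^-1 + k.+1%:R^-1)) //; last first.
    by rewrite [ltRHS]splitr ltrD.
  have := By j; rewrite /= mxE => By'.
  rewrite (le_lt_trans (ler_distD (ratr (r j)) _ _))// ltrD//.
  by rewrite distrC; exact: hr.
apply: countable_bigcupT_measurable => [|p]; first exact: countableP.
by case: pselect => ? /=; [exact: mB|exact: measurable0].
Qed.

End measurable_rV.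

Section lebesgue_rV.
Context {R : realType}.

Definition cons_rV n (p : measurableTypeR R * 'rV[R]_n) : 'rV[R]_n.+1 :=
  \row_i if unlift ord0 i is Some j then p.2 0 j else p.1.

Lemma measurable_cons_rV n : measurable_fun setT (@cons_rV n).
Proof.
apply: measurable_fun_rV => i; rewrite /cons_rV.
under eq_fun do rewrite mxE.
case: (unlift ord0 i) => [j|]; last exact: measurable_fst.
apply: (@measurableT_comp _ _ _ _ _ _ (fun x : 'rV[R]_n => x 0 j)) => //.
exact: measurable_coord.
Qed.

Fixpoint borel_lebesgue_rV n : {measure set 'rV[R]_n -> \bar R} :=
  match n with
  | 0 => dirac (0 : 'rV[R]_0)
  | n'.+1 => measure_function_pushforward__canonical__measure_function_Measure
               (lebesgue_measure \x^ borel_lebesgue_rV n')%E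
               (@measurable_cons_rV n')
  end.

(* R^n with the sigma-algebra of Lebesgue measurable sets, obtained by
   completing the Borel measure above *)
Definition eucl n := caratheodory_type (borel_lebesgue_rV n)^*%mu.

Definition lebesgue_rV n : {measure set (eucl n) -> \bar R} :=
  @completed_measure_extension _ _ _ (borel_lebesgue_rV n).

Lemma open_measurable_eucl n (A : set 'rV[R]_n) :
  open A -> measurable (A : set (eucl n)).
Proof.
move=> /open_measurable_rV mA; apply: sub_caratheodory.
exact: sub_sigma_algebra.
Qed.

End lebesgue_rV.

Arguments eucl R n : clear implicits.

Record lipschitz_domain (R : realType) n := LipschitzDomain {
  dom :> set 'rV[R]_n ;
  dom_open : open dom ;
  dom_connected : connected dom ;
  dom_nonempty : dom !=set0 ;
  dom_bounded : bounded_set dom ;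
  (* near each boundary point, up to a rigid change of coordinates, the domain
     is the strict epigraph of a Lipschitz function of n - 1 coordinates *)
  dom_lipschitz : forall x, (closure dom `\` dom) x ->
    exists (Q : 'M[R]_n) (k : 'I_n) (gamma : 'rV[R]_n.-1 -> R)
           (V : set 'rV[R]_n),
      [/\ Q *m Q^T = 1%:M,
          [lipschitz gamma z | z in setT],
          open V /\ V x &
          dom `&` V = [set z | V z /\
                       gamma (col' k (z *m Q)) < (z *m Q) 0 k] ] }.

Arguments dom_open {R n} l.

Section function_spaces.
Context {R : realType} {n : nat}.
Implicit Type Om : lipschitz_domain R n.

Definition lebesgue_on Om : {measure set (eucl R n) -> \bar R} :=
  mrestr (lebesgue_rV n) (open_measurable_eucl (dom_open Om)).

Definition L2 Om := LfunType (lebesgue_on Om) (lee1n 2 : (1 <= 2%:E)%E).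
HB.instance Definition _ Om := GRing.Lmodule.on (L2 Om).
HB.instance Definition _ Om := Choice.on (L2 Om).

Definition partial (i : 'I_n) (phi : 'rV[R]_n -> R) : 'rV[R]_n -> R :=
  'D_(delta_mx 0 i) phi.

Definition smooth (phi : 'rV[R]_n -> R) :=
  forall s : seq 'I_n, let psi := foldr partial phi s in
    continuous psi /\ forall i x, derivable psi x (delta_mx 0 i).

Definition test_function Om (phi : 'rV[R]_n -> R) :=
  smooth phi /\ exists K, [/\ compact K, K `<=` Om &
                              forall x, ~ K x -> phi x = 0].

(* the L^2(Omega) norm of a measurable f, equal to +oo when f is not in
   L^2(Omega) *)
Definition norm2 Om (f : 'rV[R]_n -> R) : \bar R :=
  'N[lebesgue_on Om]_2%:E[EFin \o f].

(* H^1_0(Omega), as the subspace of L^2(Omega)^(1+n) that consists of the pairs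
   (v, grad v): closure of {(phi, grad phi) | phi in C_c^infty(Omega)} *)
Definition H10_pred Om : {pred L2 Om * ('I_n -> L2 Om)} :=
  mem [set v : L2 Om * ('I_n -> L2 Om) |
    forall e : R, 0 < e -> exists phi, [/\ test_function Om phi,
      (norm2 Om (v.1 \- phi)%R < e%:E)%E &
      forall i, (norm2 Om (v.2 i \- partial i phi)%R < e%:E)%E]].

Arguments H10_pred : clear implicits.

Lemma continuous_measurable_eucl (phi : 'rV[R]_n -> R) :
  continuous phi -> measurable_fun [set: eucl R n] (phi : eucl R n -> R).
Proof.
move=> cphi; apply: (measurability _ (RGenOpens.measurableE R)).
move=> _ [_ [a [b ->] <-]]; rewrite setTI; apply: open_measurable_eucl.
by move/continuousP : cphi; apply; exact: interval_open.
Qed.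

Lemma smooth_lin (a : R) phi psi : smooth phi -> smooth psi ->
  smooth (a *: phi + psi)%R.
Proof.
move=> sphi spsi s.
have -> : foldr partial (a *: phi + psi)%R s =
    (a *: foldr partial phi s + foldr partial psi s)%R.
  elim: s => //= i s ->; apply/funext => x; rewrite /partial.
  have [_ /(_ i x) d1] := sphi s; have [_ /(_ i x) d2] := spsi s.
  by rewrite deriveD ?deriveZ//; exact: derivableZ.
have [c1 d1] := sphi s; have [c2 d2] := spsi s; split=> [x|i x].
  exact: (cvgD (cvgZl_tmp (k := a) (c1 x)) (c2 x)).
by apply: derivableD; [exact: derivableZ|].
Qed.

Lemma test_function_lin Om (a : R) phi psi :
  test_function Om phi -> test_function Om psi ->
  test_function Om (a *: phi + psi)%R.
Proof.
move=> [sphi [K [cK KO phi0]]] [spsi [K' [cK' KO' psi0]]]; split.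
  exact: smooth_lin.
exists (K `|` K'); split; first exact: compactU.
  by rewrite subUset.
move=> x nK; rewrite -[LHS]/(a * phi x + psi x)%R phi0 ?psi0 ?mulr0 ?addr0//.
  by move=> h; apply: nK; right.
by move=> h; apply: nK; left.
Qed.

Lemma norm2E Om (f : L2 Om) : (fine (norm2 Om f))%:E = norm2 Om f.
Proof. exact: finite_norm_fine. Qed.

Lemma norm2D Om (f g : eucl R n -> R) :
  measurable_fun [set: eucl R n] f -> measurable_fun [set: eucl R n] g ->
  (norm2 Om (f \+ g)%R <= norm2 Om f + norm2 Om g)%E.
Proof. by move=> mf mg; apply: eminkowski => //; rewrite lee1n. Qed.

Lemma norm2Z Om (a : R) (f : eucl R n -> R) :
  measurable_fun [set: eucl R n] f -> (norm2 Om f < +oo)%E ->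
  norm2 Om (a \*: (f : eucl R n -> R^o)) = (`|a|%:E * norm2 Om f)%E.
Proof.
move=> mf foo.
have fP : f \in Lfun (lebesgue_on Om) 2%:E by rewrite !inE/=; apply/andP; split; apply/mem_set.
exact: (LnormZ (Lfun_Sub (lee1n 2) fP)).
Qed.

Lemma norm20 Om : norm2 Om (cst 0 : eucl R n -> R) = 0%E.
Proof. exact: Lnorm0. Qed.

Lemma smooth0 : smooth (0 : 'rV[R]_n -> R).
Proof.
move=> s; have -> : foldr partial (0 : 'rV[R]_n -> R) s = cst 0.
  by elim: s => //= i s ->; apply/funext => x; rewrite /partial derive_cst.
by split => // x; exact: cst_continuous.
Qed.

Lemma norm2_lin_lt Om (a e : R) (u v p q : eucl R n -> R) :
  measurable_fun [set: eucl R n] u -> measurable_fun [set: eucl R n] v ->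
  measurable_fun [set: eucl R n] p -> measurable_fun [set: eucl R n] q ->
  (norm2 Om (u \- p)%R < (e / (`|a| + 1))%:E)%E ->
  (norm2 Om (v \- q)%R < (e / (`|a| + 1))%:E)%E ->
  (norm2 Om ((fun x => a * u x + v x) \- (fun x => a * p x + q x))%R < e%:E)%E.
Proof.
move=> mu mv mp mq hu hv.
have mup : measurable_fun setT (u \- p)%R by exact: measurable_funB.
have mvq : measurable_fun setT (v \- q)%R by exact: measurable_funB.
have -> : ((fun x => a * u x + v x) \- (fun x => a * p x + q x))%R =
   ((a \*: ((u \- p)%R : eucl R n -> R^o)) \+ (v \- q))%R.
  by apply/funext => x /=; rewrite /GRing.scale/=; ring.
apply: le_lt_trans (norm2D _ _ _) _ => //; first exact: measurable_funM.
rewrite norm2Z// ?(lt_trans hu) ?ltry//.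
have -> : e = `|a| * (e / (`|a| + 1)) + e / (`|a| + 1).
  by field; rewrite gt_eqF// ltr_wpDl.
rewrite EFinD EFinM; apply: lee_ltD => //.
  rewrite ge0_fin_numE ?mule_ge0 ?Lnorm_ge0 ?lee_fin//.
  by rewrite lte_mul_pinfty ?lee_fin// (lt_trans hu) ?ltry.
by rewrite lee_wpmul2l ?lee_fin// ltW.
Qed.

Lemma partial_lin (a : R) phi psi i : smooth phi -> smooth psi ->
  partial i (a *: phi + psi)%R = (a *: partial i phi + partial i psi)%R.
Proof.
move=> sphi spsi; apply/funext => x; rewrite /partial.
have [_ /(_ i x) d1] := sphi [::]; have [_ /(_ i x) d2] := spsi [::].
by rewrite deriveD ?deriveZ//; exact: derivableZ.
Qed.

Lemma smooth_measurable phi : smooth phi ->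
  measurable_fun [set: eucl R n] (phi : eucl R n -> R).
Proof. by move=> /(_ [::])[? _]; exact: continuous_measurable_eucl. Qed.

Lemma smooth_partial phi i : smooth phi -> smooth (partial i phi).
Proof.
move=> sphi s; have := sphi (rcons s i).
by rewrite -cats1 foldr_cat.
Qed.

Lemma H10_submod Om : submod_closed (H10_pred Om).
Proof.
split=> [|a u v].
  apply/mem_set => e e0; exists 0; split.
  - split; first exact: smooth0.
    by exists set0; split => //; exact: compact0.
  - by rewrite (_ : _ \- _ = 0) ?norm20 ?lte_fin//; apply/funext => x /=; rewrite subrr.
  - move=> i; rewrite (_ : _ \- _ = 0) ?norm20 ?lte_fin//; apply/funext => x /=.
    by rewrite /partial derive_cst subrr.
rewrite !inE /= => hu hv e e0.
have d0 : 0 < e / (`|a| + 1) by rewrite divr_gt0// ltr_wpDl.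
have [p [tp up gup]] := hu _ d0; have [q [tq vq gvq]] := hv _ d0.
exists (a *: p + q)%R; split; first exact: test_function_lin.
  by apply: norm2_lin_lt => //; apply: smooth_measurable; [case: tp|case: tq].
move=> i; rewrite partial_lin; [|by case: tp|by case: tq].
by apply: norm2_lin_lt => //; apply/smooth_measurable/smooth_partial; [case: tp|case: tq].
Qed.

HB.instance Definition _ Om :=
  GRing.isSubmodClosed.Build _ _ (H10_pred Om) (@H10_submod Om).

Record H10 Om := MkH10 {
  H10_val :> L2 Om * ('I_n -> L2 Om) ;
  _ : H10_val \in H10_pred Om }.
HB.instance Definition _ Om := [isSub for @H10_val Om].
HB.instance Definition _ Om := [Choice of H10 Om by <:].
HB.instance Definition _ Om := [SubChoice_isSubLmodule of H10 Om by <:].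

Definition H10_norm Om (v : H10 Om) : R :=
  Num.sqrt (fine (norm2 Om v.1) ^+ 2 + \sum_(i < n) fine (norm2 Om (v.2 i)) ^+ 2).

Lemma H10_norm_ge0 Om (v : H10 Om) : 0 <= H10_norm v.
Proof. exact: sqrtr_ge0. Qed.

Lemma H10_normZ Om (a : R) (v : H10 Om) : H10_norm (a *: v) = `|a| * H10_norm v.
Proof.
have nZ (f : L2 Om) : fine (norm2 Om (a *: f)) = `|a| * fine (norm2 Om f).
  by apply: EFin_inj; rewrite EFinM !norm2E; exact: LnormZ.
rewrite /H10_norm nZ; under eq_bigr do rewrite nZ exprMn.
by rewrite exprMn -mulr_sumr -mulrDr sqrtrM ?sqr_ge0// sqrtr_sqr normr_id.
Qed.

Lemma norm2_le_H10_norm Om (v : H10 Om) : fine (norm2 Om v.1) <= H10_norm v.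
Proof.
rewrite -[leLHS]ger0_norm ?fine_ge0 ?Lnorm_ge0// -sqrtr_sqr ler_wsqrtr// lerDl.
by apply: sumr_ge0 => i _; exact: sqr_ge0.
Qed.

(* H^{-1}(Omega), the bounded linear functionals on H^1_0(Omega) with the dual
   norm; boundedness makes them invariant under almost everywhere equality *)
Definition Hm1_pred Om : {pred H10 Om -> R} :=
  mem [set F : H10 Om -> R |
    (forall a u v, F (a *: u + v) = a * F u + F v) /\
    exists C, forall v, `|F v| <= C * H10_norm v].
Arguments Hm1_pred : clear implicits.

Lemma Hm1_submod Om : submod_closed (Hm1_pred Om).
Proof.
split=> [|a F G].
  apply/mem_set; split=> [a u v|]; first by rewrite mulr0 addr0.
  by exists 0 => v; rewrite normr0 mul0r.
rewrite !inE => -[linF [C FC]] [linG [D GD]]; split=> [b u v|].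
  rewrite /= !fctE/= linF linG /GRing.scale/=; ring.
exists (`|a| * C + D) => v; rewrite (le_trans (ler_normD _ _))// mulrDl.
by rewrite lerD// normrM -mulrA ler_wpM2l.
Qed.

HB.instance Definition _ Om :=
  GRing.isSubmodClosed.Build _ _ (Hm1_pred Om) (@Hm1_submod Om).

Record Hm1 Om := MkHm1 {
  Hm1_val :> H10 Om -> R ;
  _ : Hm1_val \in Hm1_pred Om }.
HB.instance Definition _ Om := [isSub for @Hm1_val Om].
HB.instance Definition _ Om := [Choice of Hm1 Om by <:].
HB.instance Definition _ Om := [SubChoice_isSubLmodule of Hm1 Om by <:].

Lemma Hm1_linear Om (F : Hm1 Om) a u v : F (a *: u + v) = a * F u + F v.
Proof. by case: F => F /= Fp; move: (Fp); rewrite inE => -[+ _]; exact. Qed.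

Lemma Hm1_scale Om (F : Hm1 Om) a u : F (a *: u) = a * F u.
Proof.
have F0 : F 0 = 0.
  by apply: (addIr (F 0)); rewrite add0r -[X in X + _]mul1r -Hm1_linear scaler0 addr0.
by rewrite -[a *: u]addr0 Hm1_linear F0 addr0.
Qed.

Lemma Hm1_bounded Om (F : Hm1 Om) :
  exists C, forall v, `|F v| <= C * H10_norm v.
Proof. by case: F => F /= Fp; move: (Fp); rewrite inE => -[]. Qed.

Lemma Hm1D Om (F G : Hm1 Om) v : (F + G) v = F v + G v.
Proof. by []. Qed.

Lemma Hm1Z Om a (F : Hm1 Om) v : (a *: F) v = a * F v.
Proof. by []. Qed.

Definition Hm1_norm Om (F : Hm1 Om) : R :=
  sup [set `|F v| | v in [set v | H10_norm v <= 1]].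

Lemma Hm1_has_sup Om (F : Hm1 Om) :
  has_sup [set `|F v| | v in [set v | H10_norm v <= 1]].
Proof.
have [C FC] := Hm1_bounded F; split.
  exists `|F 0|; exists 0 => //=.
  by rewrite -(scale0r 0) H10_normZ normr0 mul0r.
exists `|C| => _ [v /= v1 <-]; rewrite (le_trans (FC v))//.
rewrite (le_trans (ler_wpM2r (H10_norm_ge0 v) (ler_norm C)))//.
by rewrite -[leRHS]mulr1 ler_wpM2l.
Qed.

Lemma Hm1_le_norm Om (F : Hm1 Om) v : H10_norm v <= 1 -> `|F v| <= Hm1_norm F.
Proof.
move=> v1; apply: ub_le_sup; first by case: (Hm1_has_sup F).
by exists v.
Qed.

Lemma Hm1_norm_le Om (F : Hm1 Om) (C : R) :
  (forall v, H10_norm v <= 1 -> `|F v| <= C) -> Hm1_norm F <= C.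
Proof.
move=> h; apply: ge_sup; first by case: (Hm1_has_sup F).
by move=> _ [v /= v1 <-]; exact: h.
Qed.

Lemma Hm1_norm_triangle Om (F G : Hm1 Om) :
  Hm1_norm (F + G) <= Hm1_norm F + Hm1_norm G.
Proof.
apply: Hm1_norm_le => v v1; rewrite Hm1D (le_trans (ler_normD _ _))//.
by rewrite lerD// Hm1_le_norm.
Qed.

Lemma Hm1_normZ_le Om a (F : Hm1 Om) : Hm1_norm (a *: F) <= `|a| * Hm1_norm F.
Proof.
apply: Hm1_norm_le => v v1.
by rewrite Hm1Z normrM ler_wpM2l// Hm1_le_norm.
Qed.

Lemma Hm1_normZ Om a (F : Hm1 Om) : Hm1_norm (a *: F) = `|a| * Hm1_norm F.
Proof.
apply/eqP; rewrite eq_le Hm1_normZ_le/=; have [->|a0] := eqVneq a 0.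
  rewrite normr0 mul0r (le_trans (normr_ge0 ((0 *: F) 0)))//.
  by rewrite Hm1_le_norm// -(scale0r 0) H10_normZ normr0 mul0r.
have := Hm1_normZ_le a^-1 (a *: F); rewrite scalerA mulVf// scale1r.
by rewrite normfV ler_pdivlMl// normr_gt0.
Qed.

Lemma Hm1_norm_eq0 Om (F : Hm1 Om) : Hm1_norm F = 0 -> F = 0.
Proof.
move=> F0; apply/val_inj/funext => v /=; apply/eqP; rewrite -normr_le0.
have [v1|v1] := leP (H10_norm v) 1; first by rewrite -F0 Hm1_le_norm.
have v0 : 0 < H10_norm v by rewrite (lt_trans _ v1).
have := @Hm1_le_norm _ F ((H10_norm v)^-1 *: v).
rewrite H10_normZ normfV (gtr0_norm v0) mulVf ?gt_eqF// => /(_ (lexx _)).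
rewrite F0 Hm1_scale normrM pmulr_rle0// normr_gt0 invr_eq0 gt_eqF//.
Qed.

HB.instance Definition _ Om := @Lmodule_isNormed.Build R (Hm1 Om) _
  (@Hm1_norm_triangle Om) (@Hm1_normZ Om) (@Hm1_norm_eq0 Om).

Lemma L2_mul_integrable Om (f g : L2 Om) :
  (lebesgue_on Om).-integrable setT (EFin \o (f \* g)).
Proof. by apply/Lfun1_integrable/Lfun2_mul_Lfun1; exact: LfunP. Qed.

Definition L2_dot Om (f g : L2 Om) : R := \int[lebesgue_on Om]_x (f x * g x).

Lemma L2_dot_le Om (f g : L2 Om) :
  `|L2_dot f g| <= fine (norm2 Om f) * fine (norm2 Om g).
Proof.
have fg := L2_mul_integrable f g.
rewrite -lee_fin EFin_normr_Rintegral// EFinM !norm2E.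
apply: (le_trans (le_abse_integral _ _ _)) => //.
  by have /integrableP[] := fg.
rewrite -Lnorm1; apply: hoelder => //.
by rewrite [RHS]splitr !div1r.
Qed.

Lemma L2_to_Hm1_subproof Om (f : L2 Om) :
  (fun v : H10 Om => L2_dot f v.1) \in Hm1_pred Om.
Proof.
apply/mem_set; split=> [a u v|].
  rewrite /L2_dot -RintegralZl//; last exact: L2_mul_integrable.
  rewrite -RintegralD//.
  - by apply: eq_Rintegral => x _ /=; rewrite mulrDr mulrCA.
  - exact: (integrableZl measurableT a (L2_mul_integrable f (H10_val u).1)).
  - exact: L2_mul_integrable.
exists (fine (norm2 Om f)) => v; rewrite (le_trans (L2_dot_le _ _))//.
by rewrite ler_wpM2l ?fine_ge0 ?Lnorm_ge0// norm2_le_H10_norm.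
Qed.

Definition L2_to_Hm1 Om (f : L2 Om) : Hm1 Om := MkHm1 (L2_to_Hm1_subproof f).

End function_spaces.

Section control_problem.
Context {R : realType} {n : nat} {Om : lipschitz_domain R n}.
Local Notation mu := (lebesgue_on Om).

(* Elements of LfunType are functions, so that the linearity and the
   injectivity of a map into L^p(Omega) hold up to almost everywhere
   equality. *)
Record continuous_embedding (Y : normedModType R) (p : \bar R)
    (p1 : (1 <= p)%E) (iota : Y -> LfunType mu p1) := ContinuousEmbedding {
  embedding_linear : forall (a : R) (y z : Y),
    iota (a *: y + z) = (a *: iota y + iota z)%R %[ae mu] ;
  embedding_injective : forall y z : Y, iota y = iota z %[ae mu] -> y = z ;
  embedding_continuous : exists C : R, forall y : Y,
    ('N[mu]_p[EFin \o iota y] <= (C * `|y|)%:E)%E }.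

Definition solution_operator (Y : normedModType R) (p : \bar R)
    (p1 : (1 <= p)%E) (iota : Y -> LfunType mu p1) (Ainv : Hm1 Om -> Y)
    (f : L2 Om) : 'rV[R]_n -> R := iota (Ainv (L2_to_Hm1 f)).

Definition mul_chi (D : set 'rV[R]_n) (f : 'rV[R]_n -> R) : 'rV[R]_n -> R :=
  \1_D \* f.

Definition opnorm (T : L2 Om -> 'rV[R]_n -> R) : \bar R :=
  ereal_sup [set norm2 Om (T f) | f in [set f : L2 Om | (norm2 Om f <= 1)%E]].

Definition box_constraint (a b : L2 Om) : set (L2 Om) :=
  [set u : L2 Om | {ae mu, forall x, a x <= u x <= b x}].

Definition tracking_cost N (S : L2 Om -> 'rV[R]_n -> R)
    (D : set (eucl R n)) (mD : measurable D) (yd : L2 Om) (alpha : R)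
    (nu : 'I_N) (u : 'I_N -> L2 Om) : \bar R :=
  ((2^-1)%:E * 'N[mrestr (lebesgue_rV n) mD]_2%:E
                 [EFin \o (S (\sum_(i < N) u i)%R \- yd)%R] ^+ 2 +
   (alpha / 2)%:E * norm2 Om (u nu) ^+ 2)%E.

Definition replace_strategy N (u : 'I_N -> L2 Om) (nu : 'I_N) (v : L2 Om) :
  'I_N -> L2 Om := fun i => if i == nu then v else u i.

Definition nash_equilibrium N (Uad : 'I_N -> set (L2 Om))
    (cost : 'I_N -> ('I_N -> L2 Om) -> \bar R) (u : 'I_N -> L2 Om) :=
  (forall nu, Uad nu (u nu)) /\
  forall nu v, Uad nu v ->
    (cost nu u <= cost nu (replace_strategy u nu v))%E.

End control_problem.

Lemma lt2_le1 (R : realType) (q : R) : 2 < q -> (1 <= q%:E)%E.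
Proof. by move=> q2; rewrite lee_fin; lra. Qed.

(* Main.v *)
Require Import Defs.
From HB Require Import structures.
From mathcomp Require Import all_boot all_order all_algebra.
From mathcomp Require Import ring lra.
From mathcomp Require Import all_classical all_reals all_analysis.
From mathcomp Require Import measurable_realfun.

(** The equilibrium problem is a variational inequality for a strongly monotone
    bilinear form, so that existence and uniqueness follow from the theorem of
    Lions and Stampacchia.

    The cost of a player is a convex quadratic function of his own control.
    Hence u is an equilibrium iff no player has a feasible direction of descent
    ([equilibriumP]), and since the constraints decouple this is one
    variational inequality a(u, v - u) >= l(v - u) over the product of the
    admissible sets, with
      a(u, v) = sum_nu (chi_nu S u, S_nu v^nu) + alpha (u, v).
    The form a is not symmetric: every player observes the common state on his
    own set.  It is coercive nevertheless ([game_form_coercive]).  Put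
    t_nu = chi_Z (S_nu v^nu - chi_nu S_nu v^nu).  As S v is the sum of the
    S_nu v^nu and chi_Z chi_nu = chi_nu,
      sum_nu (chi_nu S v, S_nu v^nu) = |chi_Z S v|^2 - sum_nu (chi_Z S v, t_nu)
    and the right-hand side is at least -1/4 (sum_nu |t_nu|)^2, which the
    Cauchy-Schwarz inequality bounds from below by -1/4 (sum_nu K_nu^2) |v|^2,
    where K_nu is the operator norm in the assumption on alpha.  Uniqueness is
    immediate from coercivity; existence is [lions_stampacchia], a contraction
    argument whose step is the minimization of a quadratic functional over a
    closed convex set.

    All of this takes place in an abstract space with a degenerate inner
    product, because elements of L^2(Omega) are functions here and not classes
    of functions: vectors of norm zero need not vanish, operators are linear
    only up to such vectors, and limits are not unique.  The bilinear forms
    built from inner products do not see the difference.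

    What remains is to recognize L^2(Omega) as such a space.  It is complete
    ([riesz_fischer]), the box constraints are closed ([box_closed]),
    multiplication by a characteristic function is an orthogonal projection
    ([chi_projection]), and S is bounded on L^2(Omega) ([solution_norm_le])
    since L^q is continuously embedded in L^2 over a set of finite measure. *)

Set Implicit Arguments.
Unset Strict Implicit.
Unset Printing Implicit Defensive.
Import Order.TTheory GRing.Theory Num.Theory.
Import numFieldNormedType.Exports.
Local Open Scope classical_set_scope.
Local Open Scope ring_scope.

(** * Linear forms and one-dimensional facts *)

Section scalar_forms.
Context {R : realType} {V : lmodType R} (l : V -> R).
Hypothesis l_lin : scalar l.

Lemma form0 : l 0 = 0.
Proof. by have := l_lin (-1) 0 0; rewrite scaler0 addr0 mulN1r addNr. Qed.

Lemma formD u v : l (u + v) = l u + l v.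
Proof. by have := l_lin 1 u v; rewrite scale1r mul1r. Qed.

Lemma formZ a u : l (a *: u) = a * l u.
Proof. by have := l_lin a u 0; rewrite addr0 form0 addr0. Qed.

Lemma formN u : l (- u) = - l u.
Proof. by rewrite -scaleN1r formZ mulN1r. Qed.

Lemma formB u v : l (u - v) = l u - l v.
Proof. by rewrite formD formN. Qed.

Lemma form_sum (I : Type) (r : seq I) (P : pred I) (F : I -> V) :
  l (\sum_(i <- r | P i) F i) = \sum_(i <- r | P i) l (F i).
Proof.
elim/big_rec2: _ => [|i x y _ <-]; first exact: form0.
by rewrite formD.
Qed.

End scalar_forms.

(** The first-order condition at an end point: dividing by t and letting t tend
    to 0 leaves the slope. *)
Lemma ge0_slope (R : realFieldType) (g D : R) : 0 <= D ->
  (forall t, 0 < t -> t <= 1 -> 0 <= t * g + t ^+ 2 * D) -> 0 <= g.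
Proof.
move=> D0 h; rewrite leNgt; apply/negP => g0.
(* for g < 0 the step t = - g / (D + 1 - g) is at most 1 and gives t D < - g *)
have D1 : 0 < D + 1 - g by lra.
have t0 : 0 < - g / (D + 1 - g) by rewrite divr_gt0// oppr_gt0.
have t1 : - g / (D + 1 - g) <= 1 by rewrite ler_pdivrMr//; lra.
have := h _ t0 t1; rewrite expr2 -mulrA -mulrDr pmulr_rge0// leNgt.
move=> /negP; apply.
have : - g / (D + 1 - g) * D < - g; last by lra.
by rewrite mulrAC ltr_pdivrMr// ltr_pM2l; lra.
Qed.

Lemma le_cvgn (R : realType) (f : nat -> R) (x l : R) :
  (forall k, x <= f k) -> f k @[k --> \oo] --> l -> x <= l.
Proof.
move=> xf fl; rewrite -(cvg_lim (@Rhausdorff R) fl); apply: limr_ge.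
  by apply/cvg_ex; exists l.
exact: nearW.
Qed.

(** * Spaces with a degenerate inner product *)

Definition bilinear_form (R : realType) (V : lmodType R) (b : V -> V -> R) :=
  (forall w, scalar (b ^~ w)) /\ (forall w, scalar (b w)).

Record semi_inner_product (R : realType) (V : lmodType R)
    (dot : V -> V -> R) := SemiInnerProduct {
  sip_linl : forall w, scalar (dot ^~ w) ;
  sip_sym : forall u v, dot u v = dot v u ;
  sip_ge0 : forall u, 0 <= dot u u }.

Section semi_hilbert.
Context {R : realType} {V : lmodType R} (dot : V -> V -> R).

Definition snorm u := Num.sqrt (dot u u).

Definition snorm_cvg (u : nat -> V) (l : V) :=
  snorm (u k - l) @[k --> \oo] --> 0.

(** Completeness is asked for absolutely convergent series only: this is the
    form in which Riesz and Fischer prove it, and the sequences below all have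
    geometrically decreasing increments. *)
Definition summably_complete := forall u : nat -> V,
  cvgn (series (fun k => snorm (u k.+1 - u k))) -> exists l, snorm_cvg u l.

Definition closed_for_snorm (K : set V) :=
  forall u l, (forall k, K (u k)) -> snorm_cvg u l -> K l.

Definition segment_closed (K : set V) :=
  forall u v t, K u -> K v -> 0 <= t -> t <= 1 -> K (u + t *: (v - u)).

Definition bounded_form (b : V -> V -> R) (M : R) :=
  forall u v, `|b u v| <= M * snorm u * snorm v.

Context (sip : semi_inner_product dot).

Let dotl w : scalar (dot ^~ w). Proof. exact: sip_linl. Qed.

Lemma sip_linr w : scalar (dot w).
Proof. by move=> a u v; rewrite !(sip_sym sip w) dotl. Qed.

Let dotr := sip_linr.

Lemma snorm_ge0 u : 0 <= snorm u.
Proof. exact: sqrtr_ge0. Qed.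
Hint Resolve snorm_ge0 : core.

Lemma sqr_snorm u : snorm u ^+ 2 = dot u u.
Proof. by rewrite sqr_sqrtr// sip_ge0. Qed.

Lemma dot_line u d t :
  dot (u + t *: d) (u + t *: d) = dot u u + 2 * t * dot u d + t ^+ 2 * dot d d.
Proof.
rewrite !(formD (dotl _)) !(formD (dotr _)) !(formZ (dotl _)) !(formZ (dotr _)).
rewrite (sip_sym sip d u); ring.
Qed.

(** The discriminant argument; when |u| = 0 the quadratic polynomial
    t -> |v + t u|^2 is affine, and being nonnegative it must be constant. *)
Lemma cauchy_schwarz u v : `|dot u v| <= snorm u * snorm v.
Proof.
rewrite -(@ler_pXn2r _ 2) ?nnegrE ?mulr_ge0// exprMn !sqr_snorm.
rewrite real_normK ?num_real//.
have uu := sip_ge0 sip u; have vv := sip_ge0 sip v.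
have line t : 0 <= dot v v + 2 * t * dot u v + t ^+ 2 * dot u u.
  by rewrite (sip_sym sip u) -dot_line sip_ge0.
have [u0|u0] := eqVneq (dot u u) 0.
  rewrite u0 mul0r leNgt; apply/negP => uv0.
  have uvN0 : dot u v != 0 by apply: contraTneq uv0 => ->; rewrite expr0n ltxx.
  (* here the polynomial takes the value - |v|^2 - 2 *)
  have := line (- (dot v v + 1) / dot u v).
  by rewrite u0 mulr0 addr0 -mulrA divfK//; lra.
have := line (- dot u v / dot u u).
have -> : dot v v + 2 * (- dot u v / dot u u) * dot u v +
    (- dot u v / dot u u) ^+ 2 * dot u u =
    dot v v - dot u v ^+ 2 / dot u u by field.
by rewrite subr_ge0 ler_pdivrMr ?lt_neqAle ?uu 1?eq_sym ?u0// mulrC.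
Qed.

Lemma snormZ a u : snorm (a *: u) = `|a| * snorm u.
Proof.
rewrite /snorm (formZ (dotl _)) (formZ (dotr _)) mulrA -expr2.
by rewrite sqrtrM ?sqr_ge0// sqrtr_sqr.
Qed.

Lemma snormN u : snorm (- u) = snorm u.
Proof. by rewrite -scaleN1r snormZ normrN1 mul1r. Qed.

Lemma snorm_distC u v : snorm (u - v) = snorm (v - u).
Proof. by rewrite -snormN opprB. Qed.

Lemma snormD u v : snorm (u + v) <= snorm u + snorm v.
Proof.
rewrite -(@ler_pXn2r _ 2) ?nnegrE ?addr_ge0// sqr_snorm sqrrD !sqr_snorm.
have := dot_line u v 1; rewrite scale1r => ->.
have := cauchy_schwarz u v; have := ler_norm (dot u v); lra.
Qed.

Lemma dot_null u v : snorm u = 0 -> dot u v = 0.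
Proof.
move=> u0; apply/eqP; rewrite -normr_le0 (le_trans (cauchy_schwarz u v))//.
by rewrite u0 mul0r.
Qed.

Lemma snorm_null_dot u : dot u u <= 0 -> snorm u = 0.
Proof. by move=> h; apply/eqP; rewrite sqrtr_eq0. Qed.

Context (complete : summably_complete).

Lemma geometric_cvg (u : nat -> V) (C r : R) : 0 <= r -> r < 1 ->
  (forall k, snorm (u k.+1 - u k) <= C * r ^+ k) -> exists l, snorm_cvg u l.
Proof.
move=> r0 r1 h; apply: complete.
apply: (@series_le_cvg _ _ (geometric C r)) => //.
  by move=> k; exact: le_trans (snorm_ge0 _) (h k).
by apply: is_cvg_geometric_series; rewrite ger0_norm.
Qed.

(** The case of a symmetric form: u minimizes J(v) = |v|^2 / 2 - l(v) over K.
    A minimizing sequence that comes within 4^-k of the infimum is Cauchy by the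
    parallelogram identity, with increments of order 2^-k. *)
Lemma symmetric_vi (K : set V) (l : V -> R) (L : R) :
  K !=set0 -> segment_closed K -> closed_for_snorm K ->
  scalar l -> (forall v, `|l v| <= L * snorm v) ->
  exists2 u, K u & forall v, K v -> l (v - u) <= dot u (v - u).
Proof.
move=> [k0 Kk0] Kconv Kcl llin lL.
pose J v := dot v v / 2 - l v.
have Jline u d t : J (u + t *: d) =
    J u + t * (dot u d - l d) + t ^+ 2 * (dot d d / 2).
  by rewrite /J dot_line (formD llin) (formZ llin); field.
have Jlb v : - (L ^+ 2) / 2 <= J v.
  rewrite /J -sqr_snorm; have := lL v; rewrite ler_norml => /andP[_].
  have := sqr_ge0 (snorm v - L); rewrite sqrrB; lra.
have hinf : has_inf (J @` K).
  by split; [exists (J k0), k0|exists (- (L ^+ 2) / 2) => _ [v _ <-]].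
set m := inf (J @` K).
have mJ v : K v -> m <= J v.
  by move=> Kv; apply: ge_inf; [case: hinf|exists v].
have : forall k : nat, exists v, K v /\ J v < m + 4^-1 ^+ k.
  move=> k; have e0 : 0 < 4^-1 ^+ k :> R by rewrite exprn_gt0.
  by have [_ [v Kv <-] vm] := inf_adherent e0 hinf; exists v.
move=> /choice[u hu].
(* the midpoint of two points of K is not better than the infimum m *)
have Ju u1 v1 : K u1 -> K v1 ->
    dot (v1 - u1) (v1 - u1) <= 4 * (J u1 + J v1 - 2 * m).
  move=> Ku Kv; have := Jline u1 (v1 - u1) 1; rewrite scale1r subrKC => Jv.
  have := mJ _ (Kconv _ _ 2^-1 Ku Kv _ _); rewrite Jline => /(_ _ _)hm.
  have {hm} := hm ltac:(lra) ltac:(lra); rewrite Jv expr1n; lra.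
have [| | |w uw] := @geometric_cvg u 3 2^-1; [lra|lra| |].
  move=> k; rewrite -(@ler_pXn2r _ 2) ?nnegrE ?mulr_ge0// ?exprn_ge0//.
  rewrite sqr_snorm exprMn -exprM mulnC exprM.
  have [K1 h1] := hu k; have [K2 h2] := hu k.+1.
  apply: le_trans (Ju _ _ K1 K2) _.
  rewrite exprS in h2.
  have -> : (2^-1 ^+ 2 : R) = 4^-1 by field.
  have : 0 <= 4^-1 ^+ k :> R by rewrite exprn_ge0.
  move: h1 h2; set x := 4^-1 ^+ k => h1 h2 x0.
  have -> : 3 ^+ 2 = 9 :> R by ring.
  lra.
have Kw : K w by apply: Kcl uw => k; have [] := hu k.
exists w => // v Kv.
have Jw : J w <= m.
  have hk k : J w <= m + 4^-1 ^+ k + (snorm w + L) * snorm (u k - w).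
    have := Jline w (u k - w) 1; rewrite scale1r subrKC expr1n.
    have [_ hJ] := hu k; have := sip_ge0 sip (u k - w).
    have := cauchy_schwarz w (u k - w); rewrite ler_norml => /andP[? _].
    have := lL (u k - w); rewrite ler_norml => /andP[_ ?]; lra.
  have cv : (m + 4^-1 ^+ k + (snorm w + L) * snorm (u k - w)) @[k --> \oo]
      --> m + 0 + (snorm w + L) * 0.
    apply: cvgD; last by apply: cvgM => //; exact: cvg_cst.
    apply: cvgD; first exact: cvg_cst.
    apply: cvg_expr; rewrite ger0_norm//; lra.
  by rewrite mulr0 !addr0 in cv; exact: le_cvgn cv.
rewrite -subr_ge0; apply: (@ge0_slope _ _ (dot (v - w) (v - w) / 2)).
  by rewrite divr_ge0// sip_ge0.
move=> t t0 t1; have := mJ _ (Kconv _ _ t Kw Kv (ltW t0) t1).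
rewrite Jline; lra.
Qed.

(** The symmetric case with no constraint: the variational inequality in the
    directions v and - v is an equality. *)
Lemma riesz_representation (l : V -> R) (L : R) :
  scalar l -> (forall v, `|l v| <= L * snorm v) ->
  exists u, forall v, dot u v = l v.
Proof.
move=> llin lL.
have V0 : [set: V] !=set0 by exists 0.
have [u _ hu] := symmetric_vi V0 (fun _ _ _ _ _ _ _ => I)
  (fun _ _ _ _ => I) llin lL.
have le v : l v <= dot u v by have := hu (u + v) I; rewrite addrC addKr.
exists u => v; apply/eqP; rewrite eq_le le andbT.
by have := le (- v); rewrite (formN llin) (formN (dotr _)) lerN2.
Qed.

(** The solution is a fixed point of the map that sends u to the solution u' of
    the symmetric inequality
      (u', v - u') >= (u, v - u') - tau (a(u, v - u') - l(v - u')),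
    that is, of the projected gradient step with step size tau.  With A the
    operator that represents a, the step is Lipschitz with the constant of
    1 - tau A, whose square is at most 1 - 2 tau c + tau^2 (|M| + c + 1)^2. *)
Theorem lions_stampacchia (K : set V) (a : V -> V -> R) (l : V -> R)
    (M L c : R) :
  K !=set0 -> segment_closed K -> closed_for_snorm K ->
  bilinear_form a -> bounded_form a M ->
  0 < c -> (forall v, c * dot v v <= a v v) ->
  scalar l -> (forall v, `|l v| <= L * snorm v) ->
  exists2 u, K u & forall v, K v -> l (v - u) <= a u (v - u).
Proof.
move=> K0 Kconv Kcl [al ar] aM c0 acoer llin lL.
have [k0 Kk0] := K0.
have M0 : 0 < `|M| + c + 1 by have := normr_ge0 M; lra.
(* the minimizer of 1 - 2 tau c + tau^2 (|M| + c + 1)^2; replacing the bound M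
   by the positive number |M| + c + 1 >= c puts the minimal value in [0, 1[ *)
pose tau : R := c / (`|M| + c + 1) ^+ 2.
have tau0 : 0 < tau by rewrite divr_gt0// exprn_gt0.
have : forall u, exists u', K u' /\ forall v, K v ->
    dot u (v - u') - tau * (a u (v - u') - l (v - u')) <= dot u' (v - u').
  move=> u; have [||u' Ku' hu'] := @symmetric_vi K
    (fun v => dot u v - tau * (a u v - l v))
    (snorm u + tau * (M * snorm u + L)) K0 Kconv Kcl.
  - by move=> b v w /=; rewrite dotr ar llin; ring.
  - move=> v; rewrite mulrDl -mulrA (le_trans (ler_normB _ _))//.
    rewrite lerD ?cauchy_schwarz// normrM gtr0_norm// ler_pM2l// mulrDl.
    by rewrite (le_trans (ler_normB _ _))// lerD// aM.
  by exists u'.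
move=> /choice[step hstep].
have [A hA] := choice (fun u => riesz_representation (ar u) (aM u)).
have AM u : snorm (A u) <= `|M| * snorm u.
  have := aM u (A u); rewrite -hA -sqr_snorm ger0_norm ?sqr_ge0// expr2 => h.
  have [->|nA] := eqVneq (snorm (A u)) 0; first by rewrite mulr_ge0.
  have {}h : snorm (A u) <= M * snorm u.
    by move: h; rewrite ler_pM2r// lt_neqAle eq_sym nA snorm_ge0.
  by rewrite (le_trans h)// ler_wpM2r// ler_norm.
pose th2 := 1 - 2 * tau * c + tau ^+ 2 * (`|M| + c + 1) ^+ 2.
have th2E : th2 = 1 - tau * c.
  by rewrite /th2 /tau; field; rewrite gt_eqF.
have tc1 : tau * c <= 1.
  rewrite /tau mulrAC ler_pdivrMr ?exprn_gt0// mul1r -expr2.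
  by rewrite ler_pXn2r ?nnegrE ?ltW//; have := normr_ge0 M; lra.
have tc0 : 0 < tau * c by rewrite mulr_gt0.
have Alip e : snorm (e - tau *: A e) ^+ 2 <= th2 * snorm e ^+ 2.
  rewrite !sqr_snorm -scaleNr dot_line (sip_sym sip e) hA.
  rewrite -(sqr_snorm (A e)) -(sqr_snorm e).
  have h1 : snorm (A e) ^+ 2 <= (`|M| + c + 1) ^+ 2 * snorm e ^+ 2.
    rewrite -exprMn; apply: lerXn2r; rewrite ?nnegrE ?mulr_ge0 ?(ltW M0)//.
    by rewrite (le_trans (AM e))// ler_wpM2r//; lra.
  have := acoer e; rewrite -(sqr_snorm e) => h2.
  have h3 : tau ^+ 2 * snorm (A e) ^+ 2 <=
      tau ^+ 2 * ((`|M| + c + 1) ^+ 2 * snorm e ^+ 2).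
    by rewrite ler_wpM2l ?sqr_ge0.
  have h4 : tau * (c * snorm e ^+ 2) <= tau * a e e by rewrite ler_pM2l.
  rewrite sqrrN /th2; move: h3 h4; set x := snorm e ^+ 2.
  set y := snorm (A e) ^+ 2; set z := (_ + c + 1) ^+ 2; nra.
pose th := Num.sqrt th2.
have thK : th ^+ 2 = th2 by rewrite sqr_sqrtr// th2E subr_ge0.
have th0 : 0 <= th by exact: sqrtr_ge0.
have th1 : th < 1 by rewrite -sqrtr1 ltr_sqrt// th2E; lra.
have contr u v : snorm (step u - step v) <= th * snorm (u - v).
  have [Ku hu] := hstep u; have [Kv hv] := hstep v.
  have := hu _ Kv; have := hv _ Ku.
  set d := step u - step v.
  have -> : step v - step u = - d by rewrite opprB.
  rewrite !(formN (dotr _)) (formN (ar _)) (formN llin) => h1 h2.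
  have h3 : dot d d <= dot ((u - v) - tau *: A (u - v)) d.
    rewrite [leLHS](formB (dotl _)) [leRHS](formB (dotl _)) (formZ (dotl _)) hA.
    rewrite (formB (al _)) (formB (dotl _)); lra.
  have h4 : snorm ((u - v) - tau *: A (u - v)) <= th * snorm (u - v).
    by rewrite -(@ler_pXn2r _ 2) ?nnegrE ?mulr_ge0// exprMn thK Alip.
  have [->|nd] := eqVneq (snorm d) 0; first by rewrite mulr_ge0.
  have d0 : 0 < snorm d by rewrite lt_neqAle eq_sym nd snorm_ge0.
  rewrite -(ler_pM2r d0) -expr2 sqr_snorm (le_trans h3)//.
  rewrite (le_trans (ler_norm _))// (le_trans (cauchy_schwarz _ _))//.
  by rewrite ler_pM2r.
pose u k := iter k step k0.
have Ku k : K (u k) by case: k => [//|k]; have [] := hstep (u k).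
have [|w uw] := @geometric_cvg u (snorm (u 1%N - u 0%N)) th th0 th1.
  elim=> [|k IH]; first by rewrite mulr1.
  by rewrite (le_trans (contr _ _))// exprS mulrCA ler_wpM2l.
have Kw : K w by exact: Kcl uw.
have sw : snorm (step w - w) = 0.
  have hk k : snorm (step w - w) <= th * snorm (u k - w) + snorm (u k.+1 - w).
    have -> : step w - w = (step w - u k.+1) + (u k.+1 - w).
      by rewrite addrA subrK.
    by rewrite (le_trans (snormD _ _))// lerD2r snorm_distC contr.
  have cv : (th * snorm (u k - w) + snorm (u k.+1 - w)) @[k --> \oo]
      --> th * 0 + 0.
    apply: cvgD; first by apply: cvgM => //; exact: cvg_cst.
    by rewrite (cvg_shiftS (fun k => snorm (u k - w))).
  rewrite mulr0 addr0 in cv.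
  by apply/eqP; rewrite eq_le snorm_ge0 andbT; exact: le_cvgn cv.
(* w and its image differ by a vector of norm zero, which no form sees *)
exists w => // v Kv.
have [_ /(_ _ Kv)] := hstep w.
have -> : v - step w = (v - w) - (step w - w) by rewrite opprB addrA subrK.
set d := step w - w.
have d0 x : dot x d = 0 by rewrite (sip_sym sip) dot_null.
have ad0 : a w d = 0 by rewrite -hA d0.
have ld0 : l d = 0.
  by apply/eqP; rewrite -normr_le0 (le_trans (lL d))// sw mulr0.
have dw : dot (step w) (v - w) = dot w (v - w).
  by apply/eqP; rewrite -subr_eq0 -(formB (dotl _)) dot_null.
rewrite !(formB (dotr _) (v - w)) (formB (ar _) (v - w)) (formB llin (v - w)).
rewrite !d0 ad0 ld0 !subr0 dw => h.
have : 0 <= tau * (a w (v - w) - l (v - w)) by lra.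
by rewrite pmulr_rge0// subr_ge0.
Qed.

End semi_hilbert.

(** * Finite products *)

Section product.
Context {R : realType} {V : lmodType R} {I : finType} (dot : V -> V -> R).
Context (sip : semi_inner_product dot).

Definition prod_dot (u v : I -> V) : R := \sum_i dot (u i) (v i).

Lemma prod_sip : semi_inner_product prod_dot.
Proof.
split=> [w a u v|u v|u].
- rewrite /prod_dot /= mulr_sumr -big_split; apply: eq_bigr => i _.
  exact: (sip_linl sip).
- by apply: eq_bigr => i _; exact: sip_sym.
- by apply: sumr_ge0 => i _; exact: sip_ge0.
Qed.

Lemma snorm_le_prod (u : I -> V) i : snorm dot (u i) <= snorm prod_dot u.
Proof.
rewrite ler_wsqrtr// /prod_dot (bigD1 i)//= lerDl sumr_ge0// => j _.
exact: sip_ge0.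
Qed.

Lemma prod_cvg (u : nat -> I -> V) (l : I -> V) :
  (forall i, snorm_cvg dot (u ^~ i) (l i)) <-> snorm_cvg prod_dot u l.
Proof.
split=> [h|h i]; last first.
  apply: (@squeeze_cvgr _ _ _ _ (cst 0)
    (fun k => snorm prod_dot (u k - l))) => //.
    by apply: nearW => k; rewrite sqrtr_ge0 (snorm_le_prod (u k - l)).
  exact: cvg_cst.
rewrite /snorm_cvg -[X in _ --> X]sqrtr0.
apply: (@cvg_comp _ _ _ (fun k => prod_dot (u k - l) (u k - l)) Num.sqrt);
  last exact: sqrt_continuous.
have -> : (0 : R) = \sum_(i : I) 0 ^+ 2.
  by rewrite big1// => i _; rewrite expr0n.
have -> : (fun k => prod_dot (u k - l) (u k - l)) =
   (fun k => \sum_i snorm dot (u k i - l i) ^+ 2).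
  by apply/funext => k; apply: eq_bigr => i _; rewrite sqr_snorm.
apply: (cvg_big (op := +%R)) => [|i _]; first exact: add_continuous.
by apply: cvgM; exact: h.
Qed.

Lemma prod_complete : summably_complete dot -> summably_complete prod_dot.
Proof.
move=> comp u cu.
have /choice[l hl] : forall i, exists l, snorm_cvg dot (u ^~ i) l.
  move=> i; apply: comp; apply: series_le_cvg cu => k; rewrite ?sqrtr_ge0//.
  exact: (snorm_le_prod (u k.+1 - u k)).
by exists l; apply/prod_cvg.
Qed.

End product.

(** The product of copies of the real line is a space of the above kind. *)
Lemma sum_cauchy_schwarz (R : realType) (I : finType) (x y : I -> R) :
  (\sum_i x i * y i) ^+ 2 <= (\sum_i x i ^+ 2) * (\sum_i y i ^+ 2).
Proof.
have mulP : @semi_inner_product R R^o (fun a b => a * b).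
  split=> [w a u v|u v|u] /=; rewrite ?mulrDl ?mulrA//; first exact: mulrC.
  by rewrite -expr2 sqr_ge0.
have sP := @prod_sip _ _ I _ mulP.
have := cauchy_schwarz sP x y.
rewrite -(@ler_pXn2r _ 2) ?nnegrE ?mulr_ge0 ?sqrtr_ge0// exprMn !sqr_snorm//.
by rewrite real_normK ?num_real.
Qed.

(** * Projections and tracking terms *)

(** Linearity up to vectors of norm zero; inner products only see the operator
    up to such vectors. *)
Definition weakly_linear (R : realType) (V : lmodType R)
    (dot : V -> V -> R) (T : V -> V) :=
  forall w, scalar (fun u => dot (T u) w).

Lemma weakly_linear_snormZ (R : realType) (V : lmodType R)
    (dot : V -> V -> R) (T : V -> V) a f :
  semi_inner_product dot -> weakly_linear dot T ->
  snorm dot (T (a *: f)) = `|a| * snorm dot (T f).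
Proof.
move=> sip Tlin; have lin w := formZ (Tlin w) a f.
rewrite /snorm lin (sip_sym sip) lin mulrA -expr2 sqrtrM ?sqr_ge0//.
by rewrite sqrtr_sqr.
Qed.

Record orthogonal_projection (R : realType) (V : lmodType R)
    (dot : V -> V -> R) (P : V -> V) := OrthogonalProjection {
  proj_adj : forall f g, dot (P f) g = dot f (P g) ;
  proj_idem : forall f g, dot (P (P f)) g = dot (P f) g }.

Section projections.
Context {R : realType} {V : lmodType R} (dot : V -> V -> R).
Context (sip : semi_inner_product dot) (P : V -> V).
Context (projP : orthogonal_projection dot P).

Lemma proj_weakly_linear : weakly_linear dot P.
Proof. by move=> w a u v; rewrite !(proj_adj projP) (sip_linl sip). Qed.

Lemma dot_proj f g : dot (P f) (P g) = dot (P f) g.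
Proof. by rewrite -(proj_adj projP) (proj_idem projP). Qed.

Lemma proj_contraction f : snorm dot (P f) <= snorm dot f.
Proof.
have := cauchy_schwarz sip (P f) f; rewrite -dot_proj -sqr_snorm//.
rewrite ger0_norm ?sqr_ge0// expr2 => h.
have [->|nP] := eqVneq (snorm dot (P f)) 0; first exact: sqrtr_ge0.
by move: h; rewrite ler_pM2l// lt_neqAle eq_sym nP sqrtr_ge0.
Qed.

Context (S : V -> V) (Slin : weakly_linear dot S).

Lemma observed_bilinear : bilinear_form (fun f g => dot (P (S f)) (S g)).
Proof.
split=> w a u v /=.
  by rewrite !(proj_adj projP) Slin.
by rewrite !(sip_sym sip (P (S w))) Slin.
Qed.

Lemma unobserved_weakly_linear (Q : V -> V) : orthogonal_projection dot Q ->
  weakly_linear dot (fun f => Q (S f - P (S f))).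
Proof.
move=> projQ w a u v; rewrite !(proj_adj projQ) !(formB (sip_linl sip _)).
by rewrite !(proj_adj projP) !Slin; ring.
Qed.

Lemma observed_sym f g : dot (P (S f)) (S g) = dot (P (S g)) (S f).
Proof. by rewrite (proj_adj projP) (sip_sym sip). Qed.

Lemma tracking_expansion y x w :
  snorm dot (P (S (x + w) - y)) ^+ 2 =
  snorm dot (P (S x - y)) ^+ 2
  + 2 * (dot (P (S x)) (S w) - dot (P y) (S w)) + dot (P (S w)) (S w).
Proof.
have [bl br] := observed_bilinear.
have Plin := proj_weakly_linear.
have Q z : snorm dot (P (S z - y)) ^+ 2 =
    dot (P (S z)) (S z) - 2 * dot (P y) (S z) + dot (P y) y.
  rewrite sqr_snorm// dot_proj (formB (Plin _)) !(formB (sip_linr sip _)).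
  rewrite (_ : dot (P (S z)) y = dot (P y) (S z)); first by ring.
  by rewrite (proj_adj projP) (sip_sym sip).
rewrite !Q (formD (bl _)) !(formD (br _)) (observed_sym w x).
have lin : scalar (fun z => dot (P y) (S z)).
  by move=> a u v; rewrite !(sip_sym sip (P y)) Slin.
rewrite (formD lin); ring.
Qed.

End projections.

(** * Existence and uniqueness of equilibria *)

Section game.
Context {R : realType} {V : lmodType R} (dot : V -> V -> R).
Context (sip : semi_inner_product dot) (complete : summably_complete dot).
Context {I : finType} (S PZ : V -> V) (P : I -> V -> V) (yd : I -> V).
Context (Uad : I -> set V) (alpha C : R) (kappa : I -> R).

Definition regularized_cost i (u : I -> V) : R :=
  2^-1 * snorm dot (P i (S (\sum_j u j) - yd i)) ^+ 2 +
  alpha / 2 * snorm dot (u i) ^+ 2.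

Definition deviate (u : I -> V) i v : I -> V :=
  fun j => if j == i then v else u j.

Definition equilibrium (u : I -> V) := (forall i, Uad i (u i)) /\
  forall i v, Uad i v ->
    regularized_cost i u <= regularized_cost i (deviate u i v).

Hypothesis Slin : weakly_linear dot S.
Hypothesis Sbnd : forall f, snorm dot (S f) <= C * snorm dot f.
Hypothesis projP : forall i, orthogonal_projection dot (P i).
Hypothesis projZ : orthogonal_projection dot PZ.
Hypothesis PZP : forall i f g, dot (PZ (P i f)) g = dot (P i f) g.
Hypothesis Knorm : forall i f,
  snorm dot (PZ (S f - P i (S f))) <= kappa i * snorm dot f.
Hypothesis alphaP : 4^-1 * \sum_i kappa i ^+ 2 < alpha.

(** The derivative of the cost of player i at u in the direction w of his own
    control. *)
Definition game_slope i (u : I -> V) w : R :=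
  dot (P i (S (\sum_j u j))) (S w) - dot (P i (yd i)) (S w) +
  alpha * dot (u i) w.

Let alpha_gt0 : 0 < alpha.
Proof.
apply: le_lt_trans alphaP; rewrite mulr_ge0// sumr_ge0// => i _.
exact: sqr_ge0.
Qed.

Let observed_ge0 i w : 0 <= dot (P i (S w)) (S w).
Proof. by rewrite -(dot_proj (projP i)) sip_ge0. Qed.

Let curvature_ge0 i w :
  0 <= 2^-1 * (dot (P i (S w)) (S w) + alpha * dot w w).
Proof.
apply: mulr_ge0 => //; apply: addr_ge0; first exact: observed_ge0.
by apply: mulr_ge0; [exact: ltW|exact: sip_ge0].
Qed.

Lemma cost_deviate u i v : regularized_cost i (deviate u i v) =
  regularized_cost i u + game_slope i u (v - u i) +
  2^-1 * (dot (P i (S (v - u i))) (S (v - u i)) +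
          alpha * dot (v - u i) (v - u i)).
Proof.
rewrite /regularized_cost /game_slope {2}/deviate eqxx.
have -> : \sum_j deviate u i v j = \sum_j u j + (v - u i).
  rewrite (bigD1 i)//= [in RHS](bigD1 i)//= /deviate eqxx.
  rewrite addrAC subrKC; congr (_ + _).
  by apply: eq_bigr => j /negbTE ->.
rewrite (tracking_expansion sip (projP i) Slin).
rewrite !(sqr_snorm sip v) !(sqr_snorm sip (u i)).
have := dot_line sip (u i) (v - u i) 1; rewrite scale1r subrKC => ->.
by field.
Qed.

Hypothesis Uconv : forall i, segment_closed (Uad i).

(** The cost of player i along a segment is quadratic with slope [game_slope]
    and nonnegative curvature, so that a minimum is the same as a nonnegative
    slope in all feasible directions. *)
Lemma equilibriumP u : equilibrium u <->
  (forall i, Uad i (u i)) /\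
  forall i v, Uad i v -> 0 <= game_slope i u (v - u i).
Proof.
split=> -[Uu h]; split=> // i v Uv; last first.
  by rewrite cost_deviate -addrA lerDl addr_ge0 ?h// curvature_ge0.
set d := v - u i.
apply: (@ge0_slope _ _ (2^-1 * (dot (P i (S d)) (S d) + alpha * dot d d))).
  exact: curvature_ge0.
move=> t t0 t1; have := h i _ (Uconv (Uu i) Uv (ltW t0) t1).
rewrite cost_deviate -addrA lerDl (addrC (u i) (_ *: _)) addrK -/d.
have [bl br] := observed_bilinear sip (projP i) Slin.
have lin : scalar (fun z => dot (P i (yd i)) (S z)).
  by move=> a x w; rewrite !(sip_sym sip (P i (yd i))) Slin.
rewrite /game_slope (formZ (bl _)) !(formZ (br _)) (formZ lin).
rewrite !(formZ (sip_linl sip _)) !(formZ (sip_linr sip _)).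
lra.
Qed.

Definition game_form (u v : I -> V) : R :=
  \sum_i (dot (P i (S (\sum_j u j))) (S (v i)) + alpha * dot (u i) (v i)).

Definition game_load (v : I -> V) : R := \sum_i dot (P i (yd i)) (S (v i)).

Let sum_slope u v : \sum_i game_slope i u (v i) = game_form u v - game_load v.
Proof.
rewrite /game_form /game_load -sumrB; apply: eq_bigr => i _.
by rewrite /game_slope addrAC.
Qed.

Lemma game_form_bilinear : bilinear_form game_form.
Proof.
split=> w a u v; rewrite /game_form mulr_sumr -big_split;
  apply: eq_bigr => i _ /=.
  have [bl _] := observed_bilinear sip (projP i) Slin.
  rewrite big_split -scaler_sumr /= bl (sip_linl sip); ring.
have [_ br] := observed_bilinear sip (projP i) Slin.
rewrite br (sip_linr sip); ring.
Qed.

Lemma game_load_linear : scalar game_load.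
Proof.
move=> a u v; rewrite /game_load mulr_sumr -big_split; apply: eq_bigr => i _ /=.
by rewrite !(sip_sym sip (P i (yd i))) Slin.
Qed.

(** The key estimate.  The part of the state that player i causes but does not
    observe contributes the only terms without a sign; they are absorbed by
    completing the square in |PZ S v|. *)
Lemma game_form_coercive v :
  (alpha - 4^-1 * \sum_i kappa i ^+ 2) * prod_dot dot v v <= game_form v v.
Proof.
set W := S (\sum_j v j).
pose s i := S (v i); pose t i := PZ (s i - P i (s i)).
have Wsum x : dot W x = \sum_i dot (s i) x by rewrite /W (form_sum (Slin x)).
have dotWt i : dot (PZ W) (t i) = dot W (PZ (s i)) - dot (P i W) (s i).
  rewrite /t (dot_proj projZ) (formB (sip_linr sip _)); congr (_ - _).
    exact: (proj_adj projZ).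
  by rewrite (sip_sym sip) -(proj_adj projZ) PZP (proj_adj (projP i))
    (sip_sym sip).
have formE : game_form v v = snorm dot (PZ W) ^+ 2 - \sum_i dot (PZ W) (t i)
    + alpha * prod_dot dot v v.
  rewrite (eq_bigr _ (fun i _ => dotWt i)) sumrB.
  have -> : \sum_i dot W (PZ (s i)) = snorm dot (PZ W) ^+ 2.
    rewrite sqr_snorm// (dot_proj projZ) (sip_sym sip) Wsum.
    by apply: eq_bigr => i _; rewrite -(proj_adj projZ) (sip_sym sip).
  by rewrite /game_form big_split /= -mulr_sumr /prod_dot; ring.
have cross : \sum_i dot (PZ W) (t i) <=
    snorm dot (PZ W) * \sum_i kappa i * snorm dot (v i).
  rewrite mulr_sumr; apply: ler_sum => i _.
  rewrite (le_trans (ler_norm _))// (le_trans (cauchy_schwarz sip _ _))//.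
  by rewrite ler_wpM2l ?sqrtr_ge0// Knorm.
have := sum_cauchy_schwarz kappa (fun i => snorm dot (v i)).
rewrite (eq_bigr (fun i => dot (v i) (v i)) (fun i _ => sqr_snorm sip (v i))).
rewrite -/(prod_dot dot v v) formE.
move: cross; set x := snorm dot (PZ W); set y := \sum_i kappa i * _.
have := sqr_ge0 (x - y / 2); rewrite sqrrB; lra.
Qed.

Lemma game_form_bounded : exists M, bounded_form (prod_dot dot) game_form M.
Proof.
exists (\sum_(i : I) (\sum_(j : I) `|C| ^+ 2 + alpha)) => u v.
rewrite (le_trans (ler_norm_sum _ _ _))// -mulrA mulr_suml ler_sum// => i _.
have SC f : snorm dot (S f) <= `|C| * snorm dot f.
  by rewrite (le_trans (Sbnd f))// ler_wpM2r ?sqrtr_ge0// ler_norm.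
rewrite (le_trans (ler_normD _ _))// mulrDl lerD//; last first.
  rewrite normrM gtr0_norm// ler_wpM2l ?(ltW alpha_gt0)//.
  rewrite (le_trans (cauchy_schwarz sip _ _))//.
  by rewrite ler_pM ?sqrtr_ge0// (snorm_le_prod sip).
rewrite (le_trans (cauchy_schwarz sip _ _))//.
have sumle : snorm dot (\sum_j u j) <= \sum_(j : I) snorm (prod_dot dot) u.
  apply: (@le_trans _ _ (\sum_j snorm dot (u j))).
    elim/big_rec2: _ => [|j x y _ h].
      by rewrite /snorm (form0 (sip_linl sip _)) sqrtr0.
    by rewrite (le_trans (snormD sip _ _))// lerD2l.
  by apply: ler_sum => j _; exact: snorm_le_prod.
apply: (@le_trans _ _ ((`|C| * \sum_(j : I) snorm (prod_dot dot) u) *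
                       (`|C| * snorm (prod_dot dot) v))).
  apply: ler_pM; rewrite ?sqrtr_ge0//.
    rewrite (le_trans (proj_contraction sip (projP i) _))// (le_trans (SC _))//.
    by rewrite ler_wpM2l.
  by rewrite (le_trans (SC _))// ler_wpM2l// (snorm_le_prod sip).
rewrite !sumr_const -mulr_natl -[X in _ <= X * _]mulr_natl; lra.
Qed.

Lemma game_load_bounded :
  exists L, forall v, `|game_load v| <= L * snorm (prod_dot dot) v.
Proof.
exists (\sum_i snorm dot (P i (yd i)) * `|C|) => v.
rewrite (le_trans (ler_norm_sum _ _ _))// mulr_suml ler_sum// => i _.
rewrite (le_trans (cauchy_schwarz sip _ _))// -mulrA ler_wpM2l ?sqrtr_ge0//.
rewrite (le_trans (Sbnd _))//.
rewrite (le_trans (ler_wpM2r _ (ler_norm C))) ?sqrtr_ge0//.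
by rewrite ler_wpM2l// (snorm_le_prod sip).
Qed.

Hypothesis Unonempty : forall i, Uad i !=set0.
Hypothesis Uclosed : forall i, closed_for_snorm dot (Uad i).

(** Testing the joint variational inequality with unilateral deviations gives
    the inequality of every single player. *)
Lemma equilibrium_exists : exists u, equilibrium u.
Proof.
have [M aM] := game_form_bounded; have [L lL] := game_load_bounded.
pose K : set (I -> V) := [set u | forall i, Uad i (u i)].
have K0 : K !=set0 by have [u hu] := choice Unonempty; exists u.
have Kconv : segment_closed K.
  by move=> u v t Ku Kv t0 t1 i; apply: Uconv.
have Kcl : closed_for_snorm (prod_dot dot) K.
  move=> u l Ku ul i; apply: (@Uclosed i (u ^~ i)) => [k|]; first exact: Ku.
  by have [_ h] := prod_cvg sip u l; exact: h.
have c0 : 0 < alpha - 4^-1 * \sum_i kappa i ^+ 2 by rewrite subr_gt0.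
have [u Ku hu] := lions_stampacchia (prod_sip sip) (prod_complete sip complete)
  K0 Kconv Kcl game_form_bilinear aM c0 game_form_coercive game_load_linear lL.
exists u; apply/equilibriumP; split=> // i v Uv.
have Kdev : K (deviate u i v).
  by move=> j; rewrite /deviate; case: eqP => [->|_].
have := hu _ Kdev; rewrite -subr_ge0 -sum_slope (bigD1 i)//= big1 => [|j ji].
  by rewrite addr0 -[(_ - _) i]/(deviate u i v i - u i) /deviate eqxx.
rewrite -[(_ - _) j]/(deviate u i v j - u j) /deviate (negbTE ji) subrr.
rewrite /game_slope !(sip_sym sip _ (S 0)) !(form0 (Slin _)).
by rewrite (form0 (sip_linr sip _)) mulr0 subrr addr0.
Qed.

(** Two equilibria are admissible test points for each other; adding the two
    inequalities gives a(v - u, v - u) <= 0. *)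
Lemma equilibrium_unique u v : equilibrium u -> equilibrium v ->
  forall i, snorm dot (v i - u i) = 0.
Proof.
move=> /equilibriumP[Uu hu] /equilibriumP[Uv hv] i.
have := @sumr_ge0 _ _ (index_enum I) xpredT
  (fun j => game_slope j u (v j - u j)).
move=> /(_ (fun j _ => hu j _ (Uv j))); rewrite (sum_slope u (v - u)).
have := @sumr_ge0 _ _ (index_enum I) xpredT
  (fun j => game_slope j v (u j - v j)).
move=> /(_ (fun j _ => hv j _ (Uu j))); rewrite (sum_slope v (u - v)).
have [al ar] := game_form_bilinear.
rewrite -(opprB v u) (formN (ar _)) (formN game_load_linear) => h1 h2.
have : game_form (v - u) (v - u) <= 0.
  by rewrite (formB (al _)); lra.
move=> /(le_trans (game_form_coercive _)); rewrite pmulr_rle0 ?subr_gt0// => h.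
apply/eqP; rewrite eq_le sqrtr_ge0 andbT.
by rewrite (le_trans (snorm_le_prod sip (v - u) i))// snorm_null_dot.
Qed.

End game.

(** * Completeness of L^2 *)

Section riesz_fischer.
Context d (T : measurableType d) (R : realType).
Context (mu : {measure set T -> \bar R}).
Local Notation L2 := (LfunType mu (lee1n 2 : (1 <= 2%:E)%E)).
Local Notation "'N2[ f ]" := ('N[mu]_2%:E[EFin \o f])%E.

Lemma sqr_Lnorm2 (f : T -> R) :
  ('N2[f] ^+ 2 = \int[mu]_x (f x ^+ 2)%:E)%E.
Proof.
have n2 : (2 : R) != 0 by rewrite pnatr_eq0.
transitivity ('N2[f] `^ 2)%E.
  have := Lnorm_ge0 mu 2%:E (EFin \o f); case: ('N2[f])%E => [s| |]//= s0.
    by rewrite powR_mulrn.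
  by rewrite (negbTE n2) mulyy.
rewrite powR_Lnorm//; apply: eq_integral => x _ /=.
by rewrite powR_mulrn// real_normK ?num_real.
Qed.

Lemma Lnorm2_le (f : T -> R) (r : R) : 0 <= r ->
  ('N2[f] <= r%:E)%E = (\int[mu]_x (f x ^+ 2)%:E <= (r ^+ 2)%:E)%E.
Proof.
move=> r0; rewrite -sqr_Lnorm2.
have := Lnorm_ge0 mu 2%:E (EFin \o f); case: ('N2[f]) => [s| |]//.
by rewrite lee_fin => s0; rewrite -EFin_expe !lee_fin ler_pXn2r.
Qed.

Lemma Lnorm2_le_ae (f g : T -> R) :
  measurable_fun setT f -> measurable_fun setT g ->
  {ae mu, forall x, `|f x| <= `|g x|} -> ('N2[f] <= 'N2[g])%E.
Proof.
move=> mf mg fg; have [gfin|] := boolP ('N2[g] \is a fin_num); last first.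
  by rewrite ge0_fin_numE ?Lnorm_ge0// -leNgt leye_eq => /eqP ->; exact: leey.
have g0 : 0 <= fine 'N2[g] by rewrite fine_ge0// Lnorm_ge0.
rewrite -(fineK gfin) Lnorm2_le// EFin_expe (fineK gfin) sqr_Lnorm2.
apply: ae_ge0_le_integral => //.
- by move=> x _; rewrite lee_fin sqr_ge0.
- exact/measurable_EFinP/measurable_funX.
- by move=> x _; rewrite lee_fin sqr_ge0.
- exact/measurable_EFinP/measurable_funX.
apply: filterS fg => x fgx _; rewrite lee_fin.
rewrite -(real_normK (num_real (f x))) -(real_normK (num_real (g x))).
by rewrite lerXn2r.
Qed.

Lemma ae_eq0_Lnorm2 (f : T -> R) : measurable_fun setT f ->
  f = cst 0 %[ae mu] -> 'N2[f]%E = 0%E.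
Proof.
move=> mf f0; apply/eqP; rewrite eq_le Lnorm_ge0 andbT.
rewrite -(@Lnorm0 _ T R mu 2%:E) ?gt_eqF ?lte_fin//.
apply: Lnorm2_le_ae => //; apply: filterS f0 => x /(_ I) ->.
by rewrite normr0.
Qed.

Lemma Lfun2_mul_indic (D : set T) (f : T -> R) : measurable D ->
  f \in Lfun mu 2%:E -> (\1_D \* f)%R \in Lfun mu 2%:E.
Proof.
move=> mD /andP[]; rewrite !inE/= => mf ffin.
have mDf : measurable_fun setT (\1_D \* f)%R.
  by apply: measurable_funM => //; exact: measurable_indic.
apply/andP; split; rewrite inE//=; apply: le_lt_trans ffin.
apply: Lnorm2_le_ae => //; apply: aeW => x /=; rewrite indicE.
by case: (_ \in _); rewrite ?mul1r// mul0r normr0.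
Qed.

Let nm (f : L2) : R := fine 'N2[f].

Let nmE (f : L2) : (nm f)%:E = 'N2[f].
Proof. exact: finite_norm_fine. Qed.

Let nm_ge0 f : 0 <= nm f.
Proof. by rewrite fine_ge0// Lnorm_ge0. Qed.

Let nmD (f g : L2) : nm (f + g) <= nm f + nm g.
Proof. exact: ler_LnormD. Qed.

(** By Minkowski the partial sums G_n of the |v_k| are bounded in L^2, hence by
    monotone convergence the limit of G_n^2 is integrable and thus finite almost
    everywhere: the series converges absolutely there. *)
Lemma summable_ae_cvg (v : nat -> L2) : cvgn (series (fun k => nm (v k))) ->
  {ae mu, forall x, cvgn (series (fun k => v k x))}.
Proof.
move=> cv; set M := limn (series (fun k => nm (v k))).
have nd : {homo series (fun k => nm (v k)) : n m / (n <= m)%N >-> n <= m}.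
  by apply/nondecreasing_seqP => n; rewrite /series/= big_nat_recr//= lerDl.
have SM n : series (fun k => nm (v k)) n <= M by exact: nondecreasing_cvgn_le.
have M0 : 0 <= M by have := SM 0%N; rewrite /series/= big_geq.
pose G n x := \sum_(0 <= k < n) `|v k x|.
have mG n : measurable_fun setT (G n).
  by apply: measurable_sum => k; exact: measurableT_comp.
have G0 n x : 0 <= G n x by exact: sumr_ge0.
have GE n : ('N2[G n] <= (series (fun k => nm (v k)) n)%:E)%E.
  elim: n => [|n IH].
    have -> : G 0%N = cst 0 by apply/funext => x; rewrite /G big_geq.
    by rewrite Lnorm0// /series/= big_geq.
  have -> : G n.+1 = (G n \+ (fun x => `|v n x|))%R.
    by apply/funext => x; rewrite /G big_nat_recr.
  rewrite /series/= big_nat_recr//= [leRHS]EFinD.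
  apply: le_trans (eminkowski _ _ _ _) _; rewrite ?lee1n//.
    exact: measurableT_comp.
  rewrite leeD// nmE -[in leRHS]Lnorm_abse.
  by rewrite (_ : abse \o _ = EFin \o (fun x => `|v n x|)).
pose F n x := (G n x ^+ 2)%:E.
have mF n : measurable_fun setT (F n) by apply/measurable_EFinP/measurable_funX.
have Fge0 n x : setT x -> (0 <= F n x)%E by rewrite lee_fin sqr_ge0.
have ndG x : {homo G ^~ x : n m / (n <= m)%N >-> n <= m}.
  by apply/nondecreasing_seqP => n; rewrite /G big_nat_recr//= lerDl.
have ndF x : {homo F ^~ x : n m / (n <= m)%N >-> (n <= m)%E}.
  by move=> n m le_nm; rewrite lee_fin ler_pXn2r ?nnegrE// ndG.
have intF : (\int[mu]_x limn (F ^~ x) <= (M ^+ 2)%:E)%E.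
  rewrite (monotone_convergence mu measurableT mF Fge0 (fun x _ => ndF x)).
  apply: lime_le.
    apply: ereal_nondecreasing_is_cvgn => n m le_nm.
    apply: ge0_le_integral => //.
    - by move=> x; exact: Fge0.
    - by move=> x _; exact: ndF.
  apply: nearW => n; rewrite -Lnorm2_le// (le_trans (GE n))// lee_fin.
  exact: SM.
have F0 x : (0 <= limn (F ^~ x))%E.
  apply: lime_ge; first by apply: ereal_nondecreasing_is_cvgn; exact: ndF.
  by apply: nearW => n; rewrite lee_fin sqr_ge0.
have iF : mu.-integrable setT (fun x => limn (F ^~ x)).
  apply/integrableP; split.
    apply: (emeasurable_fun_cvg F) => //.
    by move=> x _; apply: ereal_nondecreasing_is_cvgn; exact: ndF.
  under eq_integral do rewrite gee0_abs//.
  by rewrite (le_lt_trans intF)// ltry.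
have := integrable_ae measurableT iF; apply: filterS => x /(_ I) fx.
apply: normed_cvg; apply: nondecreasing_is_cvgn; first exact: ndG.
exists (1 + fine (limn (F ^~ x))) => _ [n _ <-].
have : (F n x <= limn (F ^~ x))%E.
  rewrite (cvg_lim _ (ereal_nondecreasing_cvgn (ndF x)))//.
  by apply: ereal_sup_ubound; exists n.
rewrite -(fineK fx) lee_fin => Gle; change (G n x <= 1 + fine (limn (F ^~ x))).
(* G <= 1 + G^2 *)
have := sqr_ge0 (G n x - 1); have := G0 n x; rewrite sqrrB; lra.
Qed.

(** Fatou's lemma turns the bound on |u_n - u_(m + n)| into the same bound on
    the distance of u_n to the almost everywhere limit. *)
Theorem riesz_fischer (u : nat -> L2) :
  cvgn (series (fun k => nm (u k.+1 - u k))) ->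
  exists l : L2, nm (u k - l) @[k --> \oo] --> 0.
Proof.
move=> cu; set s := series (fun k => nm (u k.+1 - u k)).
have nd : {homo s : n m / (n <= m)%N >-> n <= m}.
  by apply/nondecreasing_seqP => n; rewrite /s/series/= big_nat_recr//= lerDl.
have sM n : s n <= limn s by exact: nondecreasing_cvgn_le.
have tail n m : nm (u (m + n)%N - u n) <= limn s - s n.
  apply: (@le_trans _ _ (s (m + n)%N - s n)); last by rewrite lerD2r.
  elim: m => [|m IH].
    by rewrite add0n !subrr /nm Lnorm0.
  rewrite addSn (_ : u (m + n).+1 - u n =
      (u (m + n).+1 - u (m + n)%N) + (u (m + n)%N - u n)).
    rewrite /s/series/= big_nat_recr//=.
    by rewrite (le_trans (nmD _ _))// [leRHS]addrAC [leRHS]addrC lerD2l.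
  by rewrite addrA subrK.
(* the upper limit is measurable and equals the limit almost everywhere *)
pose l x := fine (limn_esup (fun k => (u k x)%:E)).
have ml : measurable_fun setT l.
  apply: (measurableT_comp (fine_measurable measurableT)).
  by apply: measurable_fun_limn_esup => n; exact/measurable_EFinP.
have ul : {ae mu, forall x, u k x @[k --> \oo] --> l x}.
  apply: filterS (summable_ae_cvg cu) => x cx.
  have cux : cvgn (fun k => u k x).
    have -> : (fun k => u k x) =
        (fun k => u 0%N x + series (fun k => (u k.+1 - u k) x) k).
      by apply/funext => k; rewrite /series/= telescope_sumr// subrKC.
    by apply: is_cvgD => //; exact: is_cvg_cst.
  have cE : (u k x)%:E @[k --> \oo] --> (limn (fun k => u k x))%:E.
    by apply: cvg_EFin; [exact: nearW|exact: cux].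
  by rewrite /l (cvg_limn_einf_sup cE).2.
have dist n :
    (\int[mu]_x ((u n x - l x) ^+ 2)%:E <= ((limn s - s n) ^+ 2)%:E)%E.
  pose F m x := ((u n x - u (m + n)%N x) ^+ 2)%:E.
  have mF m : measurable_fun setT (F m).
    by apply/measurable_EFinP/measurable_funX/measurable_funB.
  have F0 m x : setT x -> (0 <= F m x)%E by move=> _; rewrite lee_fin sqr_ge0.
  apply: (@le_trans _ _ (\int[mu]_x limn_einf (F ^~ x))%E).
    apply: ae_ge0_le_integral => //.
    - by move=> x _; rewrite lee_fin sqr_ge0.
    - by apply/measurable_EFinP/measurable_funX/measurable_funB.
    - move=> x _; rewrite limn_einf_lim.
      apply: lime_ge; first exact: is_cvg_einfs.
      by apply: nearW => k; apply: le_ereal_inf_tmp => _ [m _ <-]; exact: F0.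
    - apply: measurableT_comp => //; apply: measurable_fun_limn_esup => m.
      exact: measurableT_comp.
    apply: filterS ul => x ulx _.
    rewrite (_ : limn_einf _ = ((u n x - l x) ^+ 2)%:E)//.
    apply: (cvg_limn_einf_sup _).1; apply: cvg_EFin; first exact: nearW.
    rewrite !expr2.
    have c : u n x - u (m + n)%N x @[m --> \oo] --> u n x - l x.
      apply: cvgB; first exact: cvg_cst.
      by rewrite (cvg_shiftn n (fun k => u k x)).
    exact: cvgM.
  apply: le_trans (fatou mu measurableT mF F0) _.
  rewrite limn_einf_lim; apply: lime_le; first exact: is_cvg_einfs.
  apply: nearW => m; apply: le_trans (_ : _ <= \int[mu]_x F m x)%E _.
    by apply: ereal_inf_lbound; exists m => /=.
  rewrite -(Lnorm2_le (u n - u (m + n)%N : L2)) ?subr_ge0//.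
  rewrite -nmE lee_fin; apply: le_trans (tail n m).
  by rewrite -opprB /nm LnormrN.
have dP : (u 0%N \- l)%R \in Lfun mu 2%:E.
  rewrite inE; apply/andP; split; rewrite inE/=; first exact: measurable_funB.
  rewrite /finite_norm (@le_lt_trans _ _ (limn s - s 0%N)%:E) ?ltry//.
  by rewrite Lnorm2_le ?subr_ge0//; exact: dist.
have lP : l \in Lfun mu 2%:E.
  rewrite (_ : l = (u 0%N - Lfun_Sub (lee1n 2) dP : L2)); first exact: LfunP.
  by apply/funext => x; rewrite -[RHS]/(u 0%N x - (u 0%N x - l x)) subKr.
exists (Lfun_Sub (lee1n 2) lP).
apply: (@squeeze_cvgr _ _ _ _ (cst 0) (fun n => limn s - s n)).
- apply: nearW => n; rewrite nm_ge0/= -lee_fin nmE.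
  rewrite (Lnorm2_le (u n - Lfun_Sub (lee1n 2) lP : L2)) ?subr_ge0//.
  exact: dist.
- exact: cvg_cst.
- rewrite -(subrr (limn s)); apply: cvgB; [exact: cvg_cst|exact: cu].
Qed.

(** The positive part of f - l is dominated by |u_k - l| for every k, so that
    its norm vanishes. *)
Lemma ae_le_L2_limit (f l : L2) (u : nat -> L2) :
  (forall k, {ae mu, forall x, f x <= u k x}) ->
  nm (u k - l) @[k --> \oo] --> 0 -> {ae mu, forall x, f x <= l x}.
Proof.
move=> fu ul; pose g x := Num.max (f x - l x) 0.
have mg : measurable_fun setT g.
  by apply: measurable_maxr => //; exact: measurable_funB.
have gle k : ('N2[g] <= (nm (u k - l))%:E)%E.
  rewrite nmE; apply: Lnorm2_le_ae => //; apply: filterS (fu k) => x fux.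
  rewrite -[(u k - l) x]/(u k x - l x) /g.
  case: (leP (f x - l x) 0) => h; first by rewrite normr0.
  by rewrite !ger0_norm; lra.
have g0 : 'N2[g]%E = 0%E.
  apply/eqP; rewrite eq_le Lnorm_ge0 andbT.
  have gfin : 'N2[g]%E \is a fin_num.
    by rewrite ge0_fin_numE ?Lnorm_ge0// (le_lt_trans (gle 0%N))// ltry.
  rewrite -(fineK gfin) lee_fin; apply: le_cvgn ul => k.
  by rewrite -lee_fin fineK.
have mEg : measurable_fun setT (EFin \o g) by exact/measurable_EFinP.
have p0 : (0 < 2%:E :> \bar R)%E by rewrite lte_fin.
have := Lnorm_eq0_eq0 mEg p0 g0; apply: filterS => x /(_ I) /= [gx].
by rewrite -subr_le0 -gx le_max lexx.
Qed.

End riesz_fischer.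

(** * Restriction of a measure and comparison of norms *)

Section restriction.
Context d (T : measurableType d) (R : realType).
Context (mu : {measure set T -> \bar R}).
Context (D : set T) (mD : measurable D).

Lemma ge0_integral_mrestr (f : T -> \bar R) :
  measurable_fun setT f -> (forall x, 0 <= f x)%E ->
  (\int[mrestr mu mD]_x f x = \int[mu]_(x in D) f x)%E.
Proof.
move=> mf f0; rewrite -{1}(setUv D) ge0_integral_setU//; last 3 first.
- exact: measurableC.
- exact: measurable_funTS.
- by apply/disj_setPS; rewrite setICr.
rewrite [X in (_ + X)%E](_ : _ = 0)%E ?adde0; last first.
  apply: null_set_integral => //; first exact: measurableC.
    exact: measurable_funTS.
  by rewrite /= /mrestr setICl measure0.
by apply: eq_measure_integral => A mA AD; rewrite /= /mrestr setIidl.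
Qed.

Lemma sqr_Lnorm2_mrestr (g : T -> R) : measurable_fun setT g ->
  ('N[mrestr mu mD]_2%:E[EFin \o g] ^+ 2 =
   'N[mu]_2%:E[EFin \o (\1_D \* g)%R] ^+ 2)%E.
Proof.
move=> mg; rewrite !sqr_Lnorm2 ge0_integral_mrestr//; last 2 first.
- exact/measurable_EFinP/measurable_funX.
- by move=> x; rewrite lee_fin sqr_ge0.
rewrite integral_mkcond; apply: eq_integral => x _.
by rewrite /patch /= indicE; case: ifPn => xD; rewrite ?mul1r// mul0r expr0n.
Qed.

End restriction.

Section comparison.
Context d (T : measurableType d) (R : realType).
Context (mu : {measure set T -> \bar R}).

(** Hoelder's inequality for f^2 and 1 with the exponents q / 2 and its
    conjugate. *)
Lemma Lnorm2_le_Lnorm (q : R) : 2 < q -> (mu setT < +oo)%E ->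
  exists c : R, forall (f : T -> R) (r : R), measurable_fun setT f ->
    0 <= r -> ('N[mu]_q%:E[EFin \o f] <= r%:E)%E ->
    ('N[mu]_2%:E[EFin \o f] <= (c * r)%:E)%E.
Proof.
move=> q2 muoo.
pose s := q / 2; pose s' := (1 - s^-1)^-1.
have s1 : 1 < s by rewrite /s; lra.
have s'0 : 0 < s' by rewrite invr_gt0 subr_gt0 invf_lt1//; lra.
have ss' : s^-1 + s'^-1 = 1 by rewrite /s' invrK; lra.
have m1oo : (mu setT `^ s'^-1 < +oo)%E by exact: poweR_lty.
pose c := fine (mu setT `^ s'^-1)%E.
have cE : (mu setT `^ s'^-1 = c%:E)%E.
  by rewrite fineK// ge0_fin_numE// poweR_ge0.
have c0 : 0 <= c by rewrite -lee_fin -cE poweR_ge0.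
exists (Num.sqrt c) => f r mf r0 fr; rewrite Lnorm2_le ?mulr_ge0 ?sqrtr_ge0//.
rewrite exprMn sqr_sqrtr//.
have := @hoelder _ _ _ mu (fun x => f x ^+ 2) (cst 1) s s'.
move=> /(_ (measurable_funX _ mf) (measurable_cst _)) h.
have {h} := h ltac:(lra) s'0 ss'.
rewrite Lnorm_cst1 cE Lnorm1.
under [X in (X <= _)%E -> _]eq_integral
  do rewrite /= mulr1 ger0_norm ?sqr_ge0//.
move=> /le_trans; apply.
rewrite (mulrC c) [leRHS]EFinM lee_wpmul2r ?lee_fin//.
have s0 : s != 0 by rewrite gt_eqF//; lra.
have -> : ('N[mu]_s%:E[EFin \o (fun x => (f x ^+ 2)%R)] =
         'N[mu]_q%:E[EFin \o f] `^ 2)%E.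
  rewrite unlock /Lnorm -poweRrM.
  rewrite (_ : q^-1 * 2 = s^-1); last first.
    by rewrite /s; field; rewrite gt_eqF//; lra.
  congr (_ `^ _)%E; apply: eq_integral => x _ /=.
  rewrite ger0_norm ?sqr_ge0// -(real_normK (num_real (f x))).
  rewrite -powR_mulrn// -powRrM.
  by congr (_ `^ _)%:E; rewrite /s; field.
apply: (@le_trans _ _ (r%:E `^ 2)%E).
  by rewrite gt0_ler_poweR// ?in_itv/= ?leey ?andbT ?Lnorm_ge0 ?lee_fin.
by rewrite poweR_EFin powR_mulrn.
Qed.

End comparison.

(** * Bounded domains have finite measure *)

Section finite_measure_of_domains.
Context {R : realType}.

Definition cube n (M : R) : set 'rV[R]_n := [set x | forall i, `|x 0 i| <= M].

Lemma measurable_cube n M : measurable (@cube n M).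
Proof.
have -> : cube M = ~` \bigcup_i ~`
    ((fun x : 'rV[R]_n => x 0 i : measurableTypeR R) @^-1` [set t | `|t| <= M]).
  rewrite setC_bigcup; apply/seteqP; split=> [x Bx i _|x Bx i].
    by apply; exact: Bx.
  by apply: contrapT; exact: Bx i I.
apply: measurableC; apply: countable_bigcupT_measurable => // i.
apply: measurableC; rewrite -[X in measurable X]setTI.
apply: measurable_coord => //.
rewrite (_ : [set t | _] = `[- M, M]%classic); first exact: measurable_itv.
by apply/seteqP; split=> t /=; rewrite in_itv/= ler_norml.
Qed.

(** The preimage of a cube under the chart R x R^n -> R^(n + 1) that defines the
    measure is the product of an interval with a cube. *)
Lemma borel_cube_lty n M : (borel_lebesgue_rV n (cube M) < +oo :> \bar R)%E.
Proof.
elim: n => [|n IH] /=.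
  by rewrite diracE; case: (_ \in _); rewrite ltry.
rewrite /pushforward.
have -> : cons_rV (R := R) (n := n) @^-1` cube M = `[- M, M]%classic `*` cube M.
  apply/seteqP; split=> [[t x] h|[t x] /= [h1 h2] i] /=.
    split=> [|i].
      by have := h ord0; rewrite mxE unlift_none in_itv/= ler_norml.
    by have := h (lift ord0 i); rewrite mxE liftK.
  rewrite mxE; case: unliftP => [j _|_]; first exact: h2.
  by move: h1; rewrite in_itv/= -ler_norml.
rewrite product_measure2E//; [|exact: measurable_cube].
apply: lte_mul_pinfty; [exact: measure_ge0| |exact: IH].
have itv_lty : (lebesgue_measure (`[(- M)%R, M]%classic : set R) < +oo)%E.
  by rewrite lebesgue_measure_itv/=; case: ifP; rewrite ?ltry.
by rewrite ge0_fin_numE ?measure_ge0//; exact: itv_lty.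
Qed.

Lemma lebesgue_on_lty n (Om : lipschitz_domain R n) :
  (lebesgue_on Om setT < +oo)%E.
Proof.
rewrite /lebesgue_on /= /mrestr setTI /lebesgue_rV /completed_measure_extension.
have [M OmM] : exists M, (Om : set 'rV[R]_n) `<=` cube M.
  have [M [_ hM]] := dom_bounded Om; exists (M + 1) => x Omx i.
  have := hM (M + 1) _ x Omx; rewrite ltrDl ltr01 => /(_ isT); apply: le_trans.
  rewrite -[leRHS]/(mx_norm x) mx_normrE.
  by apply: (le_bigmax _ (fun ij => `|x ij.1 ij.2|) (0, i)).
apply: (@le_lt_trans _ _ ((borel_lebesgue_rV n)^*%mu (@cube n M))).
  exact: le_outer_measure.
by rewrite measurable_mu_extE ?borel_cube_lty//; exact: measurable_cube.
Qed.

End finite_measure_of_domains.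

(** * L^2 of a domain *)

Section L2_facts.
Context {R : realType} {n : nat} (Om : lipschitz_domain R n).
Local Notation mu := (lebesgue_on Om).
Local Notation H := (L2 Om).
Local Notation dot := (@L2_dot R n Om).

Lemma L2_dot_sip : semi_inner_product dot.
Proof.
split=> [w a u v|u v|u].
- rewrite /L2_dot -RintegralZl//; last exact: L2_mul_integrable.
  rewrite -RintegralD//.
  + by apply: eq_Rintegral => x _ /=; rewrite mulrDl mulrA.
  + exact: (integrableZl measurableT a (L2_mul_integrable u w)).
  + exact: L2_mul_integrable.
- by apply: eq_Rintegral => x _; rewrite mulrC.
- by apply: Rintegral_ge0 => x _; rewrite -expr2 sqr_ge0.
Qed.

Lemma snormE (f : H) : (snorm dot f)%:E = norm2 Om f.
Proof.
rewrite -norm2E; congr EFin; apply/eqP.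
rewrite -(@eqrXn2 _ 2) ?sqrtr_ge0 ?fine_ge0 ?Lnorm_ge0// (sqr_snorm L2_dot_sip).
have -> : dot f f = fine (norm2 Om f ^+ 2)%E by rewrite /norm2 sqr_Lnorm2.
by rewrite -(norm2E f) -EFin_expe.
Qed.

Lemma snorm0_ae (f : H) : snorm dot f = 0 <-> f = cst 0 %[ae mu].
Proof.
split=> [f0|f0].
  by apply: fine_Lnormr_eq0; rewrite -[LHS]/(fine (norm2 Om f)) -snormE f0.
by apply: EFin_inj; rewrite snormE; exact: ae_eq0_Lnorm2.
Qed.

Lemma ae_eq_dot (f g w : H) : f = g %[ae mu] -> dot f w = dot g w.
Proof.
move=> fg; apply/eqP; rewrite -subr_eq0 -(formB (sip_linl L2_dot_sip w)).
rewrite (dot_null L2_dot_sip)//; apply/snorm0_ae.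
by apply: filterS fg => x /(_ I) fgx _; rewrite -[LHS]/(f x - g x) fgx subrr.
Qed.

Let snorm_fine : snorm dot = (fun f => fine (norm2 Om f)).
Proof. by apply/funext => f; rewrite -snormE. Qed.

Lemma L2_complete : summably_complete dot.
Proof.
by rewrite /summably_complete /snorm_cvg snorm_fine; exact: riesz_fischer.
Qed.

Lemma ae_le_limit (f l : H) (u : nat -> H) :
  (forall k, {ae mu, forall x, f x <= u k x}) -> snorm_cvg dot u l ->
  {ae mu, forall x, f x <= l x}.
Proof. by rewrite /snorm_cvg snorm_fine; exact: ae_le_L2_limit. Qed.

Section box.
Variables a b : H.

Lemma box_segment : segment_closed (box_constraint a b).
Proof.
move=> u v t Ku Kv t0 t1; apply: filterS2 Ku Kv => x /andP[au ub] /andP[av vb].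
rewrite -[(u + _) x]/(u x + t * (v x - u x)); apply/andP; split; nra.
Qed.

Lemma box_closed : closed_for_snorm dot (box_constraint a b).
Proof.
move=> u l Ku ul.
have al : {ae mu, forall x, a x <= l x}.
  by apply: ae_le_limit ul => k; apply: filterS (Ku k) => x /andP[].
have : {ae mu, forall x, (- b : H) x <= (- l : H) x}.
  apply: (@ae_le_limit _ _ (fun k => - u k)) => [k|].
    by apply: filterS (Ku k) => x /andP[_ ub]; rewrite -[leLHS]/(- b x) lerN2.
  rewrite /snorm_cvg; under eq_fun do rewrite -opprD (snormN L2_dot_sip).
  exact: ul.
apply: filterS2 al => x alx; rewrite -[leLHS]/(- b x) lerN2 => lb.
by rewrite alx.
Qed.

End box.

Section characteristic_multiplication.
Context (D : set (eucl R n)) (mD : measurable D).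

Lemma mul_chi_Lfun (f : H) : (mul_chi D f : eucl R n -> R) \in Lfun mu 2%:E.
Proof. exact: (Lfun2_mul_indic mD (LfunP f)). Qed.

Definition chi (f : H) : H := Lfun_Sub (lee1n 2) (mul_chi_Lfun f).

End characteristic_multiplication.

Lemma chiI (D E : set (eucl R n)) (mD : measurable D) (mE : measurable E) f :
  E `<=` D -> chi mD (chi mE f) = chi mE f.
Proof.
move=> ED; apply/val_inj/funext => x.
rewrite -[LHS]/(\1_D x * (\1_E x * f x)) -[RHS]/(\1_E x * f x) !indicE.
have [xE|] := boolP (x \in E); last by rewrite !mul0r mulr0.
by rewrite mem_set ?mul1r//; apply: ED; exact: set_mem.
Qed.

Lemma chi_projection (D : set (eucl R n)) (mD : measurable D) :
  orthogonal_projection dot (chi mD).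
Proof.
split=> f g; last by rewrite chiI.
apply: eq_Rintegral => x _.
rewrite -[chi mD f x]/(\1_D x * f x) -[chi mD g x]/(\1_D x * g x).
by rewrite mulrCA mulrA.
Qed.

Lemma opnorm_ge0 (T : H -> H) : (0 <= opnorm (fun f => T f : eucl R n -> R))%E.
Proof.
apply: (@le_trans _ _ (norm2 Om (T 0))); first exact: Lnorm_ge0.
by apply: ereal_sup_ubound; exists 0 => //=; rewrite norm20.
Qed.

(** Scaling f into the unit ball; since f may have norm zero without being zero,
    the norm of f is enlarged by an arbitrarily small amount. *)
Lemma snorm_le_opnorm (T : H -> H) (K : R) : weakly_linear dot T ->
  opnorm (fun f => T f : eucl R n -> R) = K%:E ->
  forall f, snorm dot (T f) <= K * snorm dot f.
Proof.
move=> Tlin TK f.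
have K0 : 0 <= K by rewrite -lee_fin -TK opnorm_ge0.
have ball g : snorm dot g <= 1 -> snorm dot (T g) <= K.
  move=> g1; rewrite -lee_fin snormE -TK; apply: ereal_sup_ubound.
  by exists g => //=; rewrite -snormE lee_fin.
apply/ler_addgt0Pr => e e0.
have K1 : 0 < K + 1 by lra.
have r0 : 0 < snorm dot f + e / (K + 1).
  by rewrite ltr_wpDl ?sqrtr_ge0// divr_gt0.
have := ball ((snorm dot f + e / (K + 1))^-1 *: f).
rewrite (snormZ L2_dot_sip) (weakly_linear_snormZ _ _ L2_dot_sip Tlin).
rewrite normfV gtr0_norm// ler_pdivrMl// mulr1 lerDl ltW ?divr_gt0//.
move=> /(_ isT); rewrite ler_pdivrMl// => /le_trans; apply.
rewrite mulrC mulrDr lerD2l mulrC mulrAC ler_pdivrMr// ler_pM2l//; lra.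
Qed.

End L2_facts.

(** * The control-to-state operator *)

Section control_to_state.
Context {R : realType} {n : nat} {Om : lipschitz_domain R n}.
Local Notation mu := (lebesgue_on Om).
Local Notation H := (L2 Om).
Local Notation dot := (@L2_dot R n Om).
Context (q : R) (hq : 2 < q).
Context (Y : normedModType R) (iota : Y -> LfunType mu (lt2_le1 hq)).
Context (hiota : continuous_embedding iota).
Context (A : {linear Y -> Hm1 Om}) (Ainv : Hm1 Om -> Y).
Context (hAK : cancel A Ainv) (hKA : cancel Ainv A) (hAinv : continuous Ainv).

Local Notation S := (solution_operator iota Ainv).

Lemma L2_to_Hm1_linear : linear (@L2_to_Hm1 R n Om).
Proof.
move=> a f g; apply/val_inj/funext => v /=.
exact: (sip_linl (L2_dot_sip Om)).
Qed.

Lemma L2_to_Hm1_le (f : H) : `|L2_to_Hm1 f| <= snorm dot f.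
Proof.
apply: Hm1_norm_le => v v1; rewrite (le_trans (L2_dot_le _ _))//.
rewrite -[fine (norm2 Om f)](_ : snorm dot f = _); last by rewrite -snormE.
rewrite -[leRHS]mulr1 ler_wpM2l ?sqrtr_ge0//.
exact: le_trans (norm2_le_H10_norm v) v1.
Qed.

Lemma inverse_linear : linear Ainv.
Proof. by move=> a F G; apply: (can_inj hAK); rewrite linearP !hKA. Qed.

Lemma inverse_bounded : exists2 C, 0 <= C & forall F, `|Ainv F| <= C * `|F|.
Proof.
pose B : {linear Hm1 Om -> Y} :=
  HB.pack Ainv (GRing.isLinear.Build _ _ _ _ Ainv inverse_linear).
have /linear_boundedP[M [_ hM]] := (linear_bounded_continuous B).2 hAinv.
exists (Num.max M 0 + 1) => [|F]; first by rewrite addr_ge0// le_max lexx orbT.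
by apply: hM; rewrite ltr_pwDr// le_max lexx.
Qed.

(** The chain L^2 -> H^-1 -> Y -> L^q -> L^2. *)
Lemma solution_norm_le : exists C, forall f : H,
  (norm2 Om (S f) <= (C * snorm dot f)%:E)%E.
Proof.
have [C C0 hC] := inverse_bounded; have [D hD] := embedding_continuous hiota.
have [c hc] := Lnorm2_le_Lnorm hq (lebesgue_on_lty Om).
exists (c * (`|D| * C)) => f.
rewrite -!mulrA; apply: hc => //; first by rewrite !mulr_ge0 ?sqrtr_ge0.
apply: (le_trans (hD _)); rewrite lee_fin.
rewrite (le_trans (ler_wpM2r _ (ler_norm D)))// ler_wpM2l// (le_trans (hC _))//.
by rewrite ler_wpM2l// L2_to_Hm1_le.
Qed.

Lemma solution_Lfun (f : H) : (S f : eucl R n -> R) \in Lfun mu 2%:E.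
Proof.
rewrite inE; apply/andP; split; rewrite inE//=.
have [C hC] := solution_norm_le.
by rewrite /finite_norm (le_lt_trans (hC f)) ?ltry.
Qed.

Definition solution_L2 (f : H) : H := Lfun_Sub (lee1n 2) (solution_Lfun f).

Lemma solution_L2_bounded :
  exists C, forall f, snorm dot (solution_L2 f) <= C * snorm dot f.
Proof.
have [C hC] := solution_norm_le; exists C => f.
by rewrite -lee_fin snormE; exact: hC.
Qed.

Lemma solution_L2_linear : weakly_linear dot solution_L2.
Proof.
move=> w a f g; rewrite -(sip_linl (L2_dot_sip Om)); apply: ae_eq_dot.
rewrite /solution_L2 /= /solution_operator.
have -> : Ainv (L2_to_Hm1 (a *: f + g)) =
    a *: Ainv (L2_to_Hm1 f) + Ainv (L2_to_Hm1 g).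
  by rewrite L2_to_Hm1_linear inverse_linear.
exact: embedding_linear.
Qed.

End control_to_state.

(** * The control problem *)

Section cost.
Context {R : realType} {n : nat} {Om : lipschitz_domain R n}.
Local Notation dot := (@L2_dot R n Om).

Lemma sqr_Lnorm2_observation (D : set (eucl R n)) (mD : measurable D)
    (g : L2 Om) :
  D `<=` Om ->
  ('N[mrestr (lebesgue_rV n) mD]_2%:E[EFin \o g] ^+ 2 =
   (snorm dot (chi mD g) ^+ 2)%:E)%E.
Proof.
move=> DOm; rewrite EFin_expe snormE.
rewrite -(sqr_Lnorm2_mrestr (lebesgue_on Om) mD)// !sqr_Lnorm2.
apply: eq_measure_integral => E mE _.
by rewrite /= /mrestr -setIA (setIidl DOm).
Qed.

Lemma tracking_costE N (S : L2 Om -> L2 Om) (D : 'I_N -> set (eucl R n))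
    (mD : forall i, measurable (D i)) (hD : forall i, D i `<=` Om)
    (yd : 'I_N -> L2 Om) (alpha : R) i u :
  tracking_cost S (mD i) (yd i) alpha i u =
  (regularized_cost dot S (fun i => chi (mD i)) yd alpha i u)%:E.
Proof.
rewrite /tracking_cost.
rewrite (sqr_Lnorm2_observation (mD i) (S (\sum_(j < N) u j) - yd i) (hD i)).
by rewrite -snormE -EFin_expe -!EFinM -EFinD.
Qed.

End cost.

Lemma finite_sqr_weights (R : realType) N (k : 'I_N -> \bar R) (alpha : R) :
  (forall i, 0 <= k i)%E ->
  ((4^-1)%:E * \sum_(i < N) k i ^+ 2 < alpha%:E)%E ->
  (forall i, k i = (fine (k i))%:E) /\
  4^-1 * \sum_(i < N) fine (k i) ^+ 2 < alpha.
Proof.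
move=> k0 h.
have s0 i : (0 <= k i ^+ 2)%E by rewrite expe_ge0.
have kfin i : k i = (fine (k i))%:E.
  rewrite fineK// ge0_fin_numE// ltey; apply/eqP => ki.
  have ki2 : (k i ^+ 2 = +oo)%E by rewrite ki expe2 mulyy.
  have sN : (-oo < \sum_(j < N | j != i) k j ^+ 2)%E.
    by apply: lt_le_trans ltNy0 _; exact: sume_ge0.
  move: h; rewrite (bigD1 i)// ki2 /= addye ?gt_eqF//.
  by rewrite gt0_muley ?lte_fin ?invr_gt0// ltNge leey.
split=> //; move: h; rewrite (eq_bigr (fun i => (fine (k i) ^+ 2)%:E)).
  by rewrite sumEFin -EFinM lte_fin.
by move=> i _; rewrite EFin_expe -kfin.
Qed.

Theorem theorem2p2 (R : realType) (n : nat) (hn : n \in [:: 1%N; 2%N; 3%N])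
  (Om : lipschitz_domain R n) (N : nat)
  (ua ub yd : 'I_N -> L2 Om)
  (hab : forall nu, {ae lebesgue_on Om, forall x, ua nu x <= ub nu x})
  (q : R) (hq : 2 < q)
  (Y : normedModType R) (iota : Y -> LfunType (lebesgue_on Om) (lt2_le1 hq))
  (hiota : continuous_embedding iota)
  (A : {linear Y -> Hm1 Om}) (hA : continuous A)
  (Ainv : Hm1 Om -> Y) (hAK : cancel A Ainv) (hKA : cancel Ainv A)
  (hAinv : continuous Ainv)
  (Onu : 'I_N -> set (eucl R n)) (mOnu : forall nu, measurable (Onu nu))
  (hOnu : forall nu, Onu nu `<=` Om)
  (alpha : R) :
  let S := solution_operator iota Ainv in
  let Z := \bigcup_nu Onu nu in
  ((4^-1)%:E * \sum_(nu < N)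
     opnorm (fun f => mul_chi Z (S f \- mul_chi (Onu nu) (S f))%R) ^+ 2
   < alpha%:E)%E ->
  let nash := nash_equilibrium
    (fun nu => box_constraint (ua nu) (ub nu))
    (fun nu => tracking_cost S (mOnu nu) (yd nu) alpha nu) in
  exists u, nash u /\
    forall v, nash v -> forall nu, v nu = u nu %[ae lebesgue_on Om].
Proof.
move=> S Z halpha nash.
pose dot := @L2_dot R n Om.
have sip : semi_inner_product dot := L2_dot_sip Om.
pose SL := solution_L2 hiota hAK hKA hAinv.
have SLlin : weakly_linear dot SL := solution_L2_linear hiota hAK hKA hAinv.
have [C SLbnd] : exists C, forall f, snorm dot (SL f) <= C * snorm dot f.
  exact: solution_L2_bounded.
have mZ : measurable (Z : set (eucl R n)).
  by apply: countable_bigcupT_measurable => // nu; exact: mOnu.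
pose P nu := chi (Om := Om) (mOnu nu); pose PZ := chi (Om := Om) mZ.
have projP nu : orthogonal_projection dot (P nu) by exact: chi_projection.
have projZ : orthogonal_projection dot PZ by exact: chi_projection.
have PZP nu f g : dot (PZ (P nu f)) g = dot (P nu f) g.
  by rewrite /PZ /P chiI//; exact: bigcup_sup.
pose T nu f := PZ (SL f - P nu (SL f)).
have Tlin nu : weakly_linear dot (T nu).
  exact: (unobserved_weakly_linear sip (projP nu) SLlin projZ).
have [kfin kalpha] := finite_sqr_weights (fun nu => opnorm_ge0 (T nu)) halpha.
have Knorm nu := snorm_le_opnorm (Tlin nu) (kfin nu).
pose Uad nu := box_constraint (ua nu) (ub nu).
pose eqm := equilibrium dot SL P yd Uad alpha.
have costE := tracking_costE SL mOnu hOnu yd alpha.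
have nashP u : nash u <-> eqm u.
  split=> -[Uu h]; split=> // i v Uv; have := h i v Uv.
    by rewrite /= [X in (X <= _)%E]costE [X in (_ <= X)%E]costE lee_fin.
  by rewrite /= [X in (X <= _)%E]costE [X in (_ <= X)%E]costE lee_fin.
have Uconv nu : segment_closed (Uad nu) by exact: box_segment.
have [u /nashP nu_u] : exists u, eqm u.
  apply: (equilibrium_exists sip (@L2_complete _ _ Om) yd SLlin SLbnd projP projZ
    PZP Knorm kalpha Uconv) => nu; last exact: box_closed.
  by exists (ua nu); apply: filterS (hab nu) => x ->; rewrite lexx.
exists u; split=> // v /nashP ev nu.
have /nashP eu := nu_u.
have /snorm0_ae := equilibrium_unique sip SLlin projP projZ PZP Knorm kalpha
  Uconv eu ev nu.
apply: filterS => x /(_ I) uv _; apply/eqP.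
by rewrite -subr_eq0; apply/eqP; exact: uv.
Qed.
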